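(* Let $\mathbb{F}$ be any field and let $L$ be a nilpotent symplectic alternating algebra over $\mathbb{F}$ of dimension $10$ with an isotropic center of dimension $2$ that is of class $7$ and has the further properties that $L^4L^3\neq L^7$, $L^5L^2\leq L^4L^3$ and $UL^2$ is $1$-dimensional, where $U=\{x\in L^4:\ xL^3\leq L^5L^2\}$. Then $L$ can be given by a presentation of the form $$\mathcal{P}_{10}^{(2,5)}(r):\quad (x_2y_3,y_5)=r,\ (x_3y_4,y_5)=1,\ (x_1y_2,y_5)=1,\ (y_1y_2,y_3)=1,$$ where $r\in\mathbb{F}$, $r\neq 0$. Furthermore two such presentations $\mathcal{P}_{10}^{(2,5)}(r)$ and $\mathcal{P}_{10}^{(2,5)}(s)$ describe the same algebra if and only if $s/r\in(\mathbb{F}^* )^3$.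
   Context: A symplectic alternating algebra (SAA) over a field $\mathbb{F}$ is a finite-dimensional vector space $L$ over $\mathbb{F}$ with a non-degenerate alternating bilinear form $(\ ,\ )$ and a bilinear product $\cdot$ satisfying $u\cdot u=0$ for all $u$ and $(u\cdot v,w)=(v\cdot w,u)$ for all $u,v,w\in L$. No associativity or Jacobi identity is assumed. The map $(u,v,w)\mapsto(uv,w)$ is then an alternating trilinear form. A standard basis (in dimension $10$) is a basis $x_1,y_1,\ldots,x_5,y_5$ with $(x_i,x_j)=(y_i,y_j)=0$ and $(x_i,y_j)=\delta_{ij}$ for all $i,j$. Presentations: $L$ is given by a presentation if there is a standard basis for which the listed values of triples $(uv,w)$ hold and $(uv,w)=0$ for all triples of basis elements that are not a reordering of a listed one. Two presentations describe the same algebra if the corresponding $10$-dimensional SAA's are isomorphic (by a linear bijection preserving product and form). $\mathbb{F}^*=\mathbb{F}\setminus\{0\}$, $(\mathbb{F}^* )^{3}=\{a^{3}:a\in\mathbb{F}^*\}$. For subspaces $U,V$, $UV$ is the span of all products $uv$. $L^1=L$, $L^{m+1}=L^mL$. $L$ is nilpotent if $L^{m+1}=\{0\}$ for some $m\ge 0$, and the smallest such $m$ is its (nilpotence) class. The center is $Z(L)=\{x\in L:xL=\{0\}\}$; it is isotropic if $(u,v)=0$ for all $u,v\in Z(L)$. (For $L$ of dimension $10$ and class $7$, $L^5L^2$ is a one-dimensional ideal contained in $L^7=Z(L)$.) *)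

(* Defs.v *)
From HB Require Import structures.
From mathcomp Require Import all_boot all_order all_algebra.
From mathcomp Require Import ring.

Set Implicit Arguments.
Unset Strict Implicit.
Unset Printing Implicit Defensive.

Import GRing.Theory.
Local Open Scope ring_scope.

Record saaType (F : fieldType) := SAA {
  saa_sort :> vectType F;
  saa_form : {biscalar saa_sort};
  saa_mul : {bilinear saa_sort -> saa_sort -> saa_sort};
  saa_form_alt : forall u, saa_form u u = 0;
  saa_form_nondeg : forall u, (forall v, saa_form u v = 0) -> u = 0;
  saa_mul_alt : forall u, saa_mul u u = 0;
  saa_mul_cyclic :
    forall u v w, saa_form (saa_mul u v) w = saa_form (saa_mul v w) u
}.

Notation "u *s v" := (saa_mul _ u v) (at level 40, left associativity).
Notation "''[' u , v ]" := (saa_form _ u v) (format "''[' u ,  v ]").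

Section Subspaces.
Variables (F : fieldType) (L : saaType F).
Implicit Types (U V W : {vspace L}).

(* As in falgebra.prodv, it is enough to take the products of basis elements:
   see mem_saa_prodv and saa_prodvP. *)
Definition saa_prodv U V : {vspace L} :=
  <<[seq u *s v | u <- vbasis U, v <- vbasis V]>>%VS.

Lemma mem_saa_prodv U V u v : u \in U -> v \in V -> u *s v \in saa_prodv U V.
Proof.
move=> /coord_vbasis-> /coord_vbasis->.
rewrite linear_sumr; apply: memv_suml => j _.
rewrite linear_sumlz; apply: memv_suml => i _.
rewrite linearZr_LR linearZl_LR !memvZ // memv_span //.
by apply/allpairsP; exists ((vbasis U)`_i, (vbasis V)`_j); rewrite !memt_nth.
Qed.

Lemma saa_prodvP U V W :
  reflect (forall u v, u \in U -> v \in V -> u *s v \in W)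
          (saa_prodv U V <= W)%VS.
Proof.
apply: (iffP idP) => [sUVW u v Uu Vv | sUVW].
  by rewrite (subvP sUVW) ?mem_saa_prodv.
apply/span_subvP=> _ /allpairsP[[u v] /= [Uu Vv ->]].
by rewrite sUVW ?vbasis_mem.
Qed.

(* L^m of the lower central series, for m >= 1 (junk value L^0 = L) *)
Definition saa_lcs (m : nat) : {vspace L} :=
  iter m.-1 (fun V => saa_prodv V fullv) fullv.

Definition saa_nilpotent : Prop := exists m, saa_lcs m.+1 = 0%VS.

Definition saa_class (c : nat) : Prop :=
  saa_lcs c.+1 = 0%VS /\ forall m, saa_lcs m.+1 = 0%VS -> (c <= m)%N.

(* The subspace {x in U | x V <= W}: see mem_saa_transporter. *)
Definition saa_transporter U V W : {vspace L} :=
  (U :&: \bigcap_(v <- vbasis V)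
           (linfun (applyr (saa_mul L) v) @^-1: W))%VS.

Lemma mem_saa_transporter U V W x :
  (x \in saa_transporter U V W) =
  (x \in U) && (saa_prodv <[x]> V <= W)%VS.
Proof.
rewrite memv_cap; congr (_ && _); apply/idP/saa_prodvP => [xW u v | xVW].
  case/vlineP=> a -> /coord_vbasis->; rewrite linearZl_LR linear_sumr memvZ //.
  apply: memv_suml => i _; rewrite linearZr_LR memvZ //.
  have: x \in (linfun (applyr (saa_mul L) (vbasis V)`_i) @^-1: W)%VS.
    move: xW; rewrite !memvE => /subv_trans; apply.
    by rewrite (big_rem (vbasis V)`_i) ?memt_nth //= capvSl.
  by rewrite -memv_preim lfunE.
suff: (<[x]> <= \bigcap_(v <- vbasis V)
          (linfun (applyr (saa_mul L) v) @^-1: W))%VS by [].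
rewrite big_seq; elim/big_rec: _ => [|v A Vv sxA]; first exact: subvf.
by rewrite subv_cap sxA -!memvE -memv_preim lfunE /= xVW ?memv_line ?vbasis_mem.
Qed.

Definition saa_center : {vspace L} := saa_transporter fullv fullv 0%VS.

Lemma saa_centerP x : reflect (forall v, x *s v = 0) (x \in saa_center).
Proof.
rewrite mem_saa_transporter memvf.
apply: (iffP (saa_prodvP _ _ _)) => [x0 v | x0 u v /vlineP[a ->] _].
  by apply/eqP; rewrite -memv0 x0 ?memv_line ?memvf.
by rewrite linearZl_LR x0 scaler0 mem0v.
Qed.

Definition saa_isotropic U : Prop :=
  forall u v, u \in U -> v \in U -> '[u, v] = 0.

End Subspaces.

Definition saa_isomorphic (F : fieldType) (L M : saaType F) : Prop :=
  exists f : {linear L -> M},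
    [/\ bijective f,
        forall u v, '[f u, f v] = '[u, v]
      & forall u v, f (u *s v) = f u *s f v].

(* Names for the members of a standard basis in dimension 10: 'x_i and 'y_i,
   with i from 1 to 5, stand for the ordinal of value i - 1. *)
Notation sgen := ('I_5 + 'I_5)%type.
Notation "''x_' i" := (inl (@Ordinal 5 i.-1 isT) : sgen)
  (at level 8, i at level 2, format "''x_' i").
Notation "''y_' i" := (inr (@Ordinal 5 i.-1 isT) : sgen)
  (at level 8, i at level 2, format "''y_' i").

Definition standard_basis (F : fieldType) (L : saaType F) (b : sgen -> L) :=
  [/\ basis_of fullv (codom b),
      forall i j, '[b (inl i), b (inl j)] = 0,
      forall i j, '[b (inr i), b (inr j)] = 0
    & forall i j, '[b (inl i), b (inr j)] = (i == j)%:R].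

(* The entry (u, v, w, a) of a presentation stands for (u v, w) = a. *)
Definition presentation (F : fieldType) := seq (sgen * sgen * sgen * F).

Definition presented_by (F : fieldType) (L : saaType F) (P : presentation F) :=
  exists b : sgen -> L,
    [/\ standard_basis b,
        forall u v w a, (u, v, w, a) \in P -> '[b u *s b v, b w] = a
      & forall u v w,
          (forall u' v' w' a, (u', v', w', a) \in P ->
             ~~ perm_eq [:: u; v; w] [:: u'; v'; w']) ->
          '[b u *s b v, b w] = 0].

Definition P10_2_5 (F : fieldType) (r : F) : presentation F :=
  [:: ('x_2, 'y_3, 'y_5, r); ('x_3, 'y_4, 'y_5, 1);
      ('x_1, 'y_2, 'y_5, 1); ('y_1, 'y_2, 'y_3, 1)].

(* For every r, the presentation above is that of some algebra. *)
Section Existence.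
Variables (F : fieldType) (r : F).
Let V : vectType F := ('rV[F]_5 * 'rV[F]_5)%type.
Implicit Types u v w : V.

Let coord (g : sgen) u : F :=
  match g with inl i => u.1 0 i | inr i => u.2 0 i end.
Let gen (g : sgen) : V :=
  match g with inl i => (delta_mx 0 i, 0) | inr i => (0, delta_mx 0 i) end.

Let frm u v : F := \sum_i (u.1 0 i * v.2 0 i - u.2 0 i * v.1 0 i).

Let alt3 (g h k : sgen) u v w : F :=
  coord g u * (coord h v * coord k w - coord k v * coord h w)
  - coord h u * (coord g v * coord k w - coord k v * coord g w)
  + coord k u * (coord g v * coord h w - coord h v * coord g w).

Let T u v w : F :=
  r * alt3 'x_2 'y_3 'y_5 u v w + alt3 'x_3 'y_4 'y_5 u v w
  + alt3 'x_1 'y_2 'y_5 u v w + alt3 'y_1 'y_2 'y_3 u v w.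

Let prd u v : V :=
  (\row_i T u v (gen (inr i)), - \row_i T u v (gen (inl i))).

Let sum5 (f : 'I_5 -> F) : \sum_i f i =
  f (@Ordinal 5 0 isT) + f (@Ordinal 5 1 isT) + f (@Ordinal 5 2 isT)
  + f (@Ordinal 5 3 isT) + f (@Ordinal 5 4 isT).
Proof.
rewrite !big_ord_recl big_ord0 addr0 -!addrA.
by do !congr (_ + _); congr (f _); apply: val_inj.
Qed.

Let coordP g a u v : coord g (a *: u + v) = a * coord g u + coord g v.
Proof. by case: g => i; rewrite [LHS]mxE mxE. Qed.

Let T_cyclic u v w : T u v w = T v w u.
Proof. by rewrite /T /alt3; ring. Qed.

Let T_linear a x y v w : T (a *: x + y) v w = a * T x v w + T y v w.
Proof. by rewrite /T /alt3 !coordP; ring. Qed.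

Let T_linear2 a u x y w : T u (a *: x + y) w = a * T u x w + T u y w.
Proof. by rewrite !(T_cyclic u) T_linear. Qed.

Let form_bilinear : bilinear_for
  (GRing.Scale.Law.clone _ _ *%R _) (GRing.Scale.Law.clone _ _ *%R _) frm.
Proof.
have E i a (x y : V) : ((a *: x + y).1 0 i = a * x.1 0 i + y.1 0 i) *
                 ((a *: x + y).2 0 i = a * x.2 0 i + y.2 0 i).
  by split; [exact: (coordP (inl i)) | exact: (coordP (inr i))].
by split=> [v|u] a x y /=; rewrite /applyr_head /frm !sum5 !E; ring.
Qed.

Let mul_bilinear : bilinear_for
  (GRing.Scale.Law.clone _ _ *:%R _) (GRing.Scale.Law.clone _ _ *:%R _) prd.
Proof.
split=> [v|u] a x y /=; rewrite /applyr_head /prd; congr (_, _); apply/rowP=> i;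
  by rewrite !mxE ?T_linear ?T_linear2 ?mulrN -?opprD.
Qed.

Let frm_biscalar : {biscalar V} :=
  HB.pack frm (bilinear_isBilinear.Build F V V F *%R *%R frm form_bilinear).
Let prd_bilinear : {bilinear V -> V -> V} :=
  HB.pack prd (bilinear_isBilinear.Build F V V V *:%R *:%R prd mul_bilinear).

Let prd_trilinear u v w : frm (prd u v) w = T u v w.
Proof.
rewrite /frm sum5 /prd /= !mxE /T /alt3 /coord /gen /= !mxE /=.
ring.
Qed.

Let frm_gen v g : frm (gen g) v =
  match g with inl i => v.2 0 i | inr i => - v.1 0 i end.
Proof.
case: g => i; rewrite /frm /= (bigD1 i) //= !mxE !eqxx big1 => [|j /negPf ji].
- by rewrite mulr1n; ring.
- by rewrite !mxE ji mulr0n; ring.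
- by rewrite mulr1n; ring.
by rewrite !mxE ji mulr0n; ring.
Qed.

Let coord_gen g h : coord g (gen h) = (g == h)%:R.
Proof. by case: g => i; case: h => j; rewrite /= mxE. Qed.

Let alt3_0 a b c g h k : ~~ perm_eq [:: g; h; k] [:: a; b; c] ->
  alt3 a b c (gen g) (gen h) (gen k) = 0.
Proof.
move=> ghk; rewrite /alt3 !coord_gen.
have M p q s : perm_eq [:: p; q; s] [:: a; b; c] ->
    (p == g)%:R * ((q == h)%:R * (s == k)%:R) = 0 :> F.
  case: (p =P g) => [->|]; last by rewrite mul0r.
  case: (q =P h) => [->|]; last by rewrite mul0r mulr0.
  case: (s =P k) => [->|]; last by rewrite !mulr0.
  by rewrite (negPf ghk).
by rewrite !mulrBr !M ?subr0 ?addr0 //; apply/permP=> P /=; ring.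
Qed.

Lemma P10_2_5_exists : exists L : saaType F, presented_by L (P10_2_5 r).
Proof.
have frm_alt u : frm u u = 0 by rewrite /frm big1 // => i _; ring.
have frmN u v : frm u v = - frm v u by rewrite /frm -sumrN; apply: eq_bigr => i _; ring.
have nondeg u : (forall v, frm u v = 0) -> u = 0.
  move=> u0; case: u u0 => u1 u2 u0; congr (_, _); apply/rowP=> i; rewrite mxE.
    by move: (u0 (gen (inr i))); rewrite frmN frm_gen /= opprK.
  by move: (u0 (gen (inl i))); rewrite frmN frm_gen => /eqP; rewrite oppr_eq0 => /eqP.
have prd_alt u : prd u u = 0.
  by apply: nondeg => w; rewrite prd_trilinear /T /alt3; ring.
have cyc u v w : frm (prd u v) w = frm (prd v w) u.
  by rewrite !prd_trilinear /T /alt3; ring.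
exists (@SAA F V frm_biscalar prd_bilinear frm_alt nondeg prd_alt cyc), gen; split.
- split.
  + rewrite basisEdim dimvf size_codom card_sum !card_ord andbT.
    apply/subvP=> v _; have -> : v = \sum_g coord g v *: gen g.
      rewrite big_sumType /=; case: v => v1 v2.
      rewrite [X in X + _](_ : _ = (v1, 0)); last first.
        rewrite [in RHS](row_sum_delta v1); elim/big_rec2: _ => // k a b _ ->.
        by congr (_, _); exact: etrans (addr0 _) (scaler0 _ _).
      rewrite [X in _ + X](_ : _ = (0, v2)).
        by congr (_, _); [exact: esym (addr0 _) | exact: esym (add0r _)].
      rewrite [in RHS](row_sum_delta v2); elim/big_rec2: _ => // k a b _ ->.
      by congr (_, _); exact: etrans (addr0 _) (scaler0 _ _).
    by apply: memv_suml => g _; rewrite memvZ // memv_span // codom_f.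
  + by move=> i j; apply: etrans (frm_gen _ _) _; rewrite mxE.
  + by move=> i j; apply: etrans (frm_gen _ _) _; rewrite mxE oppr0.
  + by move=> i j; apply: etrans (frm_gen _ _) _; rewrite mxE eqxx.
- move=> g h k a; rewrite !inE => /or4P[] /eqP[-> -> -> ->];
    by rewrite /saa_form /saa_mul /= prd_trilinear /T /alt3 /= !mxE /=; ring.
move=> g h k ghk; rewrite /saa_form /saa_mul /= prd_trilinear.
have A e : e \in P10_2_5 r ->
    alt3 e.1.1.1 e.1.1.2 e.1.2 (gen g) (gen h) (gen k) = 0.
  by case: e => [[[a b] c] d] /ghk/alt3_0.
rewrite /T (A ('x_2, 'y_3, 'y_5, r)) ?(A ('x_3, 'y_4, 'y_5, 1));
  rewrite ?(A ('x_1, 'y_2, 'y_5, 1)) ?(A ('y_1, 'y_2, 'y_3, 1)) ?mulr0 ?addr0 //;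
  by rewrite !inE eqxx ?orbT.
Qed.
End Existence.

(* Main.v *)
From HB Require Import structures.
Require Import Defs.
From mathcomp Require Import all_boot all_order all_algebra.
From mathcomp Require Import ring zify.
Set Implicit Arguments.
Unset Strict Implicit.
Unset Printing Implicit Defensive.
Import GRing.Theory.
Local Open Scope ring_scope.

(** The argument is carried by the alternating trilinear form [(u v, w)], which
    together with the symplectic form determines the product.

    Multiplication by an element of [L] is self-adjoint for the form, so [L^i]
    and [L^j] are orthogonal once [L^(i + j - 1) = 0] ([orth_lcs]); for an
    algebra of class 7 this gives [L^i L^j = 0] for [i + j >= 8].  Together with
    non-degeneracy, a center of dimension 2 then forces the dimensions
    10, 8, 7, 6, 4, 3, 2 of [L], ..., [L^7], the equality of [L^7] with the
    center, and that [L^(9 - i)] is the orthogonal complement of [L^i]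
    ([dim_lcs], [lcs7_center], [perp_lcs_eq]).

    Vectors [x_1], ..., [x_5] chosen along the terms [L^4], ..., [L^7] span a
    maximal isotropic subspace and extend to a standard basis adapted to the
    series.  All but twenty of the structure constants vanish for reasons of
    level.  The hypotheses on [L^5 L^2], [L^4 L^3] and [U L^2] allow [x_5] to
    span [L^5 L^2] and [x_1] to be taken in [U] with [x_1 L^2] on the line of
    [x_5]; this kills four more ([adapted_basis]).  Of the sixteen that remain,
    the four of the final presentation are nonzero: for [(y_1 y_2, y_3)] this
    is where [L^4 L^3 <> L^7] enters ([rough_presentation]).  Three changes of
    basis remove the other twelve and a diagonal one normalizes three of the
    four ([normal_form]).

    In an algebra given by the final presentation, the upper central series, its
    orthogonal complements and [U] are spanned by parts of the basis.  They do
    not depend on the basis, so two bases of this kind are related by a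
    triangular change of basis, and its diagonal entries multiply [r] by a cube
    ([same_algebra_cube]).  Conversely a diagonal change of basis multiplies [r]
    by any given cube. *)

(** * Presentations as alternating trilinear forms *)

Lemma perm_eq3 (T : eqType) (x1 x2 x3 : T) s : perm_eq [:: x1; x2; x3] s ->
  s \in [:: [:: x1; x2; x3]; [:: x2; x3; x1]; [:: x3; x1; x2];
            [:: x2; x1; x3]; [:: x1; x3; x2]; [:: x3; x2; x1]].
Proof.
have two (y1 y2 : T) t : perm_eq t [:: y1; y2] ->
    t = [:: y1; y2] \/ t = [:: y2; y1].
  case: t => [|z t] st; first by have := perm_size st.
  have : z \in [:: y1; y2] by rewrite -(perm_mem st) mem_head.
  rewrite !inE => /orP[] /eqP zE; move: st; rewrite zE.
    by rewrite perm_cons => /perm_small_eq ->; [left|].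
  by rewrite perm_sym (perm_catC [:: y1] [:: y2]) perm_sym perm_cons =>
    /perm_small_eq ->; [right|].
rewrite perm_sym; case: s => [|z s] st; first by have := perm_size st.
have : z \in [:: x1; x2; x3] by rewrite -(perm_mem st) mem_head.
rewrite in_cons => /predU1P[zE|].
  move: st; rewrite zE perm_cons => /two[] ->; by rewrite !inE eqxx ?orbT.
rewrite !inE => /orP[] /eqP zE; move: st; rewrite zE perm_sym.
  rewrite (perm_catC [:: x1] [:: x2; x3]) perm_sym perm_cons => /two[] ->;
    by rewrite ?inE eqxx ?orbT.
rewrite (perm_catC [:: x1; x2] [:: x3]) perm_sym perm_cons => /two[] ->;
  by rewrite ?inE eqxx ?orbT.
Qed.

(** An alternating form needs to be evaluated at only one ordering of each
    triple. *)
Lemma perm_alt_eq0 (T : eqType) (R : zmodType) (f : T -> T -> T -> R)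
    x y z x' y' z' :
    (forall x y z, f x y z = f y z x) -> (forall x y z, f x y z = - f y x z) ->
    perm_eq [:: x'; y'; z'] [:: x; y; z] ->
  f x' y' z' = 0 -> f x y z = 0.
Proof.
move=> f_cyc fC /perm_eq3 xyz f0.
have f0' : f y' x' z' = 0 by rewrite fC f0 oppr0.
move: xyz; rewrite !inE => /or4P [||| /or3P[]] /eqP[-> -> ->] //.
- by rewrite -f_cyc.
- by rewrite f_cyc.
- by rewrite -f_cyc.
- by rewrite f_cyc.
Qed.

Section Basics.
Variables (F : fieldType) (L : saaType F).
Implicit Types (u v w x y : L) (a : F) (U V W : {vspace L}).

Lemma saa_formDl u v w : '[u + v, w] = '[u, w] + '[v, w].
Proof. exact: linearDl. Qed.
Lemma saa_formDr u v w : '[u, v + w] = '[u, v] + '[u, w].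
Proof. exact: linearDr. Qed.
Lemma saa_formZl a u v : '[a *: u, v] = a * '[u, v].
Proof. exact: linearZl_LR. Qed.
Lemma saa_formZr a u v : '[u, a *: v] = a * '[u, v].
Proof. exact: linearZr_LR. Qed.
Lemma saa_formNl u v : '[- u, v] = - '[u, v].
Proof. exact: linearNl. Qed.
Lemma saa_formNr u v : '[u, - v] = - '[u, v].
Proof. exact: linearNr. Qed.
Lemma saa_form0l v : '[0 : L, v] = 0.
Proof. exact: linear0l. Qed.
Lemma saa_form0r v : '[v, 0 : L] = 0.
Proof. exact: linear0r. Qed.
Definition saa_form_lin :=
  (saa_formDl, saa_formDr, saa_formZl, saa_formZr, saa_formNl, saa_formNr,
   saa_form0l, saa_form0r).

Lemma saa_form_suml I r (P : pred I) (f : I -> L) v :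
  '[\sum_(i <- r | P i) f i, v] = \sum_(i <- r | P i) '[f i, v].
Proof. exact: linear_sumlz. Qed.
Lemma saa_form_sumr I r (P : pred I) (f : I -> L) v :
  '[v, \sum_(i <- r | P i) f i] = \sum_(i <- r | P i) '[v, f i].
Proof. exact: linear_sumr. Qed.

Lemma saa_formC u v : '[u, v] = - '[v, u].
Proof.
apply/eqP; rewrite -addr_eq0; apply/eqP.
have := saa_form_alt (u + v).
by rewrite !saa_form_lin !saa_form_alt add0r addr0.
Qed.

Lemma saa_mulDl u v w : (u + v) *s w = u *s w + v *s w.
Proof. exact: linearDl. Qed.
Lemma saa_mulDr u v w : u *s (v + w) = u *s v + u *s w.
Proof. exact: linearDr. Qed.
Lemma saa_mulZl a u v : (a *: u) *s v = a *: (u *s v).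
Proof. exact: linearZl_LR. Qed.
Lemma saa_mulZr a u v : u *s (a *: v) = a *: (u *s v).
Proof. exact: linearZr_LR. Qed.
Lemma saa_mulNl u v : (- u) *s v = - (u *s v).
Proof. exact: linearNl. Qed.
Lemma saa_mulNr u v : u *s (- v) = - (u *s v).
Proof. exact: linearNr. Qed.
Lemma saa_mul0l v : 0 *s v = 0.
Proof. exact: linear0l. Qed.
Lemma saa_mul0r v : v *s 0 = 0.
Proof. exact: linear0r. Qed.
Definition saa_mul_lin :=
  (saa_mulDl, saa_mulDr, saa_mulZl, saa_mulZr, saa_mulNl, saa_mulNr,
   saa_mul0l, saa_mul0r).

Lemma saa_mulC u v : u *s v = - (v *s u).
Proof.
apply/eqP; rewrite -addr_eq0; apply/eqP.
by have := saa_mul_alt (u + v); rewrite !saa_mul_lin !saa_mul_alt add0r addr0.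
Qed.

(** By non-degeneracy this alternating trilinear form carries the same
    information as the product. *)
Definition trip u v w : F := '[u *s v, w].

Lemma trip_cyc u v w : trip u v w = trip v w u.
Proof. exact: saa_mul_cyclic. Qed.
Lemma tripC u v w : trip u v w = - trip v u w.
Proof. by rewrite /trip saa_mulC saa_formNl. Qed.
Lemma tripCr u v w : trip u v w = - trip u w v.
Proof. by rewrite trip_cyc tripC -trip_cyc. Qed.
Lemma trip_alt u v : trip u u v = 0.
Proof. by rewrite /trip saa_mul_alt saa_form0l. Qed.
Lemma trip_lin a u v w x :
  trip (a *: u + v) w x = a * trip u w x + trip v w x.
Proof. by rewrite /trip !saa_mul_lin !saa_form_lin. Qed.

End Basics.

Section Coordinates.
Variables (F : fieldType) (L : saaType F) (b : sgen -> L).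
Implicit Types (u v w : L) (g h k : sgen) (P : presentation F).

(** In a standard basis a coordinate is the pairing with the dual generator. *)
Definition bcoord g u : F :=
  match g with inl i => '[u, b (inr i)] | inr i => '[b (inl i), u] end.

Lemma bcoord_lin g a u v : bcoord g (a *: u + v) = a * bcoord g u + bcoord g v.
Proof. by case: g => i; rewrite /= !saa_form_lin. Qed.

Definition det3 g h k u v w : F :=
  bcoord g u * (bcoord h v * bcoord k w - bcoord k v * bcoord h w)
  - bcoord h u * (bcoord g v * bcoord k w - bcoord k v * bcoord g w)
  + bcoord k u * (bcoord g v * bcoord h w - bcoord h v * bcoord g w).

(** The alternating trilinear form with the structure constants [P]. *)
Definition psum P u v w : F :=
  \sum_(e <- P) e.2 * det3 e.1.1.1 e.1.1.2 e.1.2 u v w.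

(** Unlike [presented_by] this speaks of all vectors: a change of basis then
    amounts to a polynomial identity between coordinates. *)
Definition given_by P :=
  standard_basis b /\ forall u v w, trip u v w = psum P u v w.

Lemma det3_cyc g h k u v w : det3 g h k u v w = det3 g h k v w u.
Proof. rewrite /det3; ring. Qed.
Lemma det3C g h k u v w : det3 g h k u v w = - det3 g h k v u w.
Proof. rewrite /det3; ring. Qed.

Lemma det3_lin g h k a u v w x :
  det3 g h k (a *: u + v) w x = a * det3 g h k u w x + det3 g h k v w x.
Proof. rewrite /det3 !bcoord_lin; ring. Qed.

Lemma psum_cyc P u v w : psum P u v w = psum P v w u.
Proof. by apply: eq_bigr => e _; rewrite det3_cyc. Qed.
Lemma psumC P u v w : psum P u v w = - psum P v u w.
Proof. by rewrite /psum -sumrN; apply: eq_bigr => e _; rewrite det3C mulrN. Qed.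
Lemma psum_lin P a u v w x :
  psum P (a *: u + v) w x = a * psum P u w x + psum P v w x.
Proof.
rewrite /psum mulr_sumr -big_split; apply: eq_bigr => e _ /=.
by rewrite det3_lin; ring.
Qed.

Hypothesis bP : standard_basis b.

Lemma bcoord_basis g h : bcoord g (b h) = (g == h)%:R.
Proof.
case: bP => _ xx yy xy; case: g h => i [] j //=.
by rewrite xy eq_sym.
Qed.

Lemma bcoord_eq0 u : (forall g, bcoord g u = 0) -> u = 0.
Proof.
move=> u0; have [B _ _ _] := bP; apply: saa_form_nondeg => v.
have : (<<codom b>> <= lker (linfun (saa_form L u : L -> F^o)))%VS.
  apply/span_subvP=> _ /codomP[g ->]; rewrite memv_ker lfunE /=.
  apply/eqP; case: g => i; last exact: (u0 (inl i)).
  by rewrite saa_formC [X in - X](u0 (inr i)) oppr0.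
rewrite (span_basis B) => /subvP/(_ v (memvf v)).
by rewrite memv_ker lfunE => /eqP.
Qed.

Lemma bcoord_sum (c : sgen -> F) g : bcoord g (\sum_h c h *: b h) = c g.
Proof.
transitivity (\sum_h c h * bcoord g (b h)).
  elim/big_rec2: _ => [|h y1 y2 _ <-]; last exact: bcoord_lin.
  by case: g => i /=; rewrite saa_form_lin.
rewrite (bigD1 g) //= bcoord_basis eqxx mulr1 big1 ?addr0 // => h hg.
by rewrite bcoord_basis eq_sym (negPf hg) mulr0.
Qed.

Lemma bcoord_inj u v : (forall g, bcoord g u = bcoord g v) -> u = v.
Proof.
move=> uv; apply/eqP; rewrite -subr_eq0; apply/eqP/bcoord_eq0 => g.
by rewrite addrC -scaleN1r bcoord_lin uv mulN1r addNr.
Qed.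

Lemma bcoord_expand u : u = \sum_g bcoord g u *: b g.
Proof. by apply: bcoord_inj => g; rewrite bcoord_sum. Qed.
Lemma saa_form_coord u v :
  '[u, v] = \sum_i (bcoord (inl i) u * bcoord (inr i) v
                    - bcoord (inr i) u * bcoord (inl i) v).
Proof.
rewrite {1}[u]bcoord_expand saa_form_suml big_sumType big_split /=.
congr (_ + _); apply: eq_bigr => i _; rewrite saa_formZl //.
by rewrite -mulrN -saa_formC.
Qed.

Lemma linear_eq0 (f : L -> F) :
    (forall a u v, f (a *: u + v) = a * f u + f v) ->
  (forall g, f (b g) = 0) -> forall u, f u = 0.
Proof.
move=> fL fb u; have f0 : f 0 = 0.
  by have := fL (-1) 0 0; rewrite scaler0 addr0 mulN1r addNr.
rewrite [u]bcoord_expand; elim/big_rec: _ => // g x _ x0.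
by rewrite fL fb x0 mulr0 addr0.
Qed.

Definition supp (e : sgen * sgen * sgen * F) := [:: e.1.1.1; e.1.1.2; e.1.2].

Lemma det3_basis_eq g h k : uniq [:: g; h; k] ->
  det3 g h k (b g) (b h) (b k) = 1.
Proof.
rewrite /= !inE negb_or => /and3P[/andP[/negPf gh /negPf gk] /negPf hk _].
rewrite /det3 !bcoord_basis !eqxx gh gk hk ![k == _]eq_sym ![h == g]eq_sym.
by rewrite gh gk hk /=; ring.
Qed.

Lemma det3_basis_neq g h k g' h' k' :
  ~~ perm_eq [:: g'; h'; k'] [:: g; h; k] ->
  det3 g h k (b g') (b h') (b k') = 0.
Proof.
move=> nP; rewrite /det3 !bcoord_basis.
have M p q s : perm_eq [:: p; q; s] [:: g'; h'; k'] ->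
    (g == p)%:R * ((h == q)%:R * (k == s)%:R) = 0 :> F.
  case: (g =P p) => [<-|]; last by rewrite mul0r.
  case: (h =P q) => [<-|]; last by rewrite mul0r mulr0.
  case: (k =P s) => [<-|]; last by rewrite !mulr0.
  by rewrite perm_sym (negPf nP).
transitivity
  ((g == g')%:R * ((h == h')%:R * (k == k')%:R)
   - (g == g')%:R * ((h == k')%:R * (k == h')%:R)
   - (g == h')%:R * ((h == g')%:R * (k == k')%:R)
   + (g == k')%:R * ((h == g')%:R * (k == h')%:R)
   + (g == h')%:R * ((h == k')%:R * (k == g')%:R)
   - (g == k')%:R * ((h == h')%:R * (k == g')%:R) : F).
  by ring.
by rewrite !M ?subr0 ?addr0 //; apply/permP=> Q /=; ring.
Qed.

(** Under this condition the determinants of different entries do not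
    interfere with one another on the basis. *)
Definition simple P :=
  all (fun e => uniq (supp e)) P &&
  pairwise (fun e e' => ~~ perm_eq (supp e) (supp e')) P.

Lemma psum_basis_neq P g h k :
    (forall e, e \in P -> ~~ perm_eq [:: g; h; k] (supp e)) ->
  psum P (b g) (b h) (b k) = 0.
Proof.
move=> nP; rewrite /psum big_seq big1 // => e /nP ne.
by rewrite det3_basis_neq ?mulr0.
Qed.

Lemma psum_basis_eq P e : simple P -> e \in P ->
  psum P (b e.1.1.1) (b e.1.1.2) (b e.1.2) = e.2.
Proof.
move=> /andP[]; elim: P => // e' P IH /= /andP[ue' uP] /andP[ne' nP].
rewrite in_cons /psum big_cons -/(psum P _ _ _) => /predU1P[->|eP].
  rewrite det3_basis_eq // mulr1 psum_basis_neq ?addr0 // => f fP.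
  exact: (allP ne').
by rewrite IH // det3_basis_neq ?mulr0 ?add0r // perm_sym (allP ne').
Qed.

(** Both sides are alternating and trilinear, so they are compared on the
    triples of basis elements, one ordering of each. *)
Lemma given_byP P : simple P ->
  (forall g h k a, (g, h, k, a) \in P -> trip (b g) (b h) (b k) = a) ->
  (forall g h k,
     (forall e, e \in P -> ~~ perm_eq [:: g; h; k] (supp e)) ->
     trip (b g) (b h) (b k) = 0) ->
  given_by P.
Proof.
move=> sP valP zeroP; split=> // u v w.
pose D u v w := trip u v w - psum P u v w.
have D_cyc x y z : D x y z = D y z x by rewrite /D trip_cyc psum_cyc.
have DC x y z : D x y z = - D y x z.
  by rewrite /D tripC psumC opprB opprK addrC.
have D_lin a x y z t : D (a *: x + y) z t = a * D x z t + D y z t.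
  by rewrite /D trip_lin psum_lin; ring.
have D_basis g h k : D (b g) (b h) (b k) = 0.
  case: (boolP (all (fun e => ~~ perm_eq [:: g; h; k] (supp e)) P)).
    by move=> /allP nP; rewrite /D zeroP // psum_basis_neq // subrr.
  rewrite -has_predC => /hasP[[[[g' h'] k'] a] eP /negPn /=].
  rewrite perm_sym => ghk.
  have De : D (b g') (b h') (b k') = 0.
    by rewrite /D (valP _ _ _ _ eP) (psum_basis_eq sP eP) subrr.
  by apply: (perm_alt_eq0 (f := fun g h k => D (b g) (b h) (b k))) ghk De.
apply/eqP; rewrite -subr_eq0 -/(D u v w); apply/eqP; move: u.
apply: linear_eq0 => [a x y|g]; first exact: D_lin.
rewrite D_cyc; move: v; apply: linear_eq0 => [a x y|h]; first exact: D_lin.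
rewrite D_cyc; move: w; apply: linear_eq0 => [a x y|k]; first exact: D_lin.
by rewrite D_cyc.
Qed.
End Coordinates.

Lemma forall_I5 (P : 'I_5 -> Prop) :
  P (@Ordinal 5 0 isT) -> P (@Ordinal 5 1 isT) -> P (@Ordinal 5 2 isT) ->
  P (@Ordinal 5 3 isT) -> P (@Ordinal 5 4 isT) -> forall i, P i.
Proof.
move=> P0 P1 P2 P3 P4 [[|[|[|[|[|m]]]]] lt_m] //;
  by rewrite (bool_irrelevance lt_m isT).
Qed.

Definition sgens : seq sgen :=
  [:: 'x_1; 'x_2; 'x_3; 'x_4; 'x_5; 'y_1; 'y_2; 'y_3; 'y_4; 'y_5].

Lemma mem_sgens g : g \in sgens.
Proof. by case: g; apply: forall_I5. Qed.

Lemma sum_I5 (V : nmodType) (f : 'I_5 -> V) :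
  \sum_i f i = f (@Ordinal 5 0 isT) + f (@Ordinal 5 1 isT)
    + f (@Ordinal 5 2 isT) + f (@Ordinal 5 3 isT) + f (@Ordinal 5 4 isT).
Proof.
rewrite !big_ord_recl big_ord0 addr0 !addrA.
by congr (f _ + f _ + f _ + f _ + f _); apply: val_inj.
Qed.

Section Change.
Variables (F : fieldType) (L : saaType F).
Implicit Types (b : sgen -> L) (P : presentation F).

Lemma given_by_presented b P : simple P -> given_by b P -> presented_by L P.
Proof.
move=> sP [bP bT]; exists b; split=> // [u v w a eP | u v w nP].
  by rewrite -/(trip _ _ _) bT (psum_basis_eq bP sP eP).
rewrite -/(trip _ _ _) bT psum_basis_neq // => [[[[u' v'] w'] a]].
exact: nP.
Qed.

Lemma presented_given_by P : simple P -> presented_by L P ->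
  exists b : sgen -> L, given_by b P.
Proof.
move=> sP [b [bP bval bzero]]; exists b; apply: given_byP => // u v w nP.
by apply: bzero => u' v' w' a /nP.
Qed.

Definition basis_of_seqs (xs ys : seq L) (g : sgen) : L :=
  match g with inl i => nth 0 xs i | inr i => nth 0 ys i end.

Lemma standard_basis_dim b : standard_basis b -> \dim {:L} = 10%N.
Proof.
case=> B _ _ _; have := @size_basis _ _ _ _ (codom_tuple b) B.
by rewrite card_sum !card_ord.
Qed.

Lemma saa_form_basis b : standard_basis b ->
  (forall i j, ('[b (inl i), b (inl j)] = 0) *
    ('[b (inr i), b (inr j)] = 0) * ('[b (inl i), b (inr j)] = (i == j)%:R) *
    ('[b (inr i), b (inl j)] = - (i == j)%:R)).
Proof.
case=> _ xx yy xy i j; do !split; rewrite ?xx ?yy ?xy //.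
by rewrite saa_formC xy eq_sym.
Qed.

(** The relations force linear independence, since the dual generators read off
    the coefficients; the dimension does the rest. *)
Lemma standard_basisI b : \dim {:L} = 10%N ->
    (forall i j, '[b (inl i), b (inl j)] = 0) ->
    (forall i j, '[b (inr i), b (inr j)] = 0) ->
    (forall i j, '[b (inl i), b (inr j)] = (i == j)%:R) ->
  standard_basis b.
Proof.
move=> dL xx yy xy; split=> //.
have cardE : #|{: sgen}| = 10%N by rewrite card_sum !card_ord.
rewrite basisEfree subvf size_codom cardE dL /= andbT.
have bcoord_b g h : bcoord b g (b h) = (g == h)%:R.
  by case: g h => i [] j //=; rewrite xy eq_sym.
have coord0 g : bcoord b g 0 = 0 by case: g => i; rewrite /= saa_form_lin.
apply/(@freeP _ _ _ (codom_tuple b)) => k k0 i.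
have : bcoord b (enum_val i) (\sum_j k j *: (codom_tuple b)`_j) =
       \sum_j k j * (enum_val i == enum_val j)%:R.
  elim/big_rec2: _ => [|j y1 y2 _ <-]; first exact: coord0.
  by rewrite bcoord_lin nth_codom bcoord_b.
rewrite k0 coord0 (bigD1 i) //= eqxx mulr1 big1 => [|j ji]; last first.
  by rewrite (inj_eq enum_val_inj) eq_sym (negPf ji) mulr0.
by rewrite addr0.
Qed.
End Change.

Section Scaling.
Variables (F : fieldType) (L : saaType F) (l : 'I_5 -> F).
Hypothesis l_neq0 : forall i, l i != 0.

Definition dual_weight (g : sgen) : F :=
  match g with inl i => (l i)^-1 | inr i => l i end.

Definition scale_pres (P : presentation F) : presentation F :=
  [seq (e.1, e.2 * dual_weight e.1.1.1 * dual_weight e.1.1.2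
             * dual_weight e.1.2) | e <- P].

(** A diagonal symplectic change of basis rescales each entry by itself. *)
Lemma given_by_scale (b : sgen -> L) P :
  given_by b P -> given_by (fun g => dual_weight g *: b g) (scale_pres P).
Proof.
case=> bP bT; split.
  apply: standard_basisI; first exact: standard_basis_dim bP.
  - by move=> i j; rewrite !saa_form_lin (saa_form_basis bP) !mulr0.
  - by move=> i j; rewrite !saa_form_lin (saa_form_basis bP) !mulr0.
  move=> i j; rewrite !saa_form_lin (saa_form_basis bP) /=.
  by case: eqP => [->|_]; rewrite ?mulr0 // mulKf.
move=> u v w; rewrite bT /psum big_map; apply: eq_bigr => -[[[g h] k] a] _ /=.
have cE t z : bcoord b t z
    = dual_weight t * bcoord (fun g => dual_weight g *: b g) t z.
  case: t => i /=; rewrite !saa_form_lin.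
    by rewrite mulKf ?l_neq0.
  by rewrite mulVKf ?l_neq0.
rewrite /det3 !cE; ring.
Qed.
End Scaling.

(** * Reduction to the normal form *)

Section NormalForm.
Variables (F : fieldType) (L : saaType F).

Ltac I5 := do ?[apply: forall_I5].

Ltac check_standard bP :=
  apply: standard_basisI; [exact: standard_basis_dim bP | I5 ..];
  rewrite /= ?saa_form_lin ?(saa_form_basis bP) /=; ring.

(** The entries are grouped by the step that removes them: those that [pres16]
    adds to [pres10] go first, those of [pres4] stay. *)
Definition pres4 (r f e q : F) : presentation F :=
  [:: ('x_2, 'y_3, 'y_5, r); ('x_3, 'y_4, 'y_5, f);
      ('x_1, 'y_2, 'y_5, e); ('y_1, 'y_2, 'y_3, q)].

Definition pres7 (r f e q y1 y2 y3 : F) : presentation F :=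
  pres4 r f e q ++
  [:: ('y_1, 'y_4, 'y_5, y1); ('y_2, 'y_4, 'y_5, y2); ('y_3, 'y_4, 'y_5, y3)].

Definition pres10 (r f e q y1 y2 y3 g x1 x2 : F) : presentation F :=
  pres7 r f e q y1 y2 y3 ++
  [:: ('x_1, 'y_3, 'y_5, g); ('x_1, 'y_4, 'y_5, x1); ('x_2, 'y_4, 'y_5, x2)].

Definition pres16 (r f e q y1 y2 y3 g x1 x2 a1 a2 a3 b1 b2 b3 : F) :
    presentation F :=
  pres10 r f e q y1 y2 y3 g x1 x2 ++
  [:: ('y_2, 'y_3, 'y_4, a1); ('y_1, 'y_3, 'y_4, a2); ('y_1, 'y_2, 'y_4, a3);
      ('y_2, 'y_3, 'y_5, b1); ('y_1, 'y_3, 'y_5, b2); ('y_1, 'y_2, 'y_5, b3)].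

(** Adding a combination of [y_1], [y_2], [y_3] to [y_4] changes the 2-form
    [(u v, y_4)] by any prescribed combination of the three coordinate minors in
    [y_1], [y_2], [y_3], since [q] is not 0; so the entries [a_i] can be
    cancelled, and likewise the [b_i] with [y_5].  The dual correction of the
    [x_i] is central. *)
Lemma clear_yyy (b : sgen -> L)
    (r f e q y1 y2 y3 g x1 x2 a1 a2 a3 b1 b2 b3 : F) :
    q != 0 ->
    given_by b (pres16 r f e q y1 y2 y3 g x1 x2 a1 a2 a3 b1 b2 b3) ->
  exists b' : sgen -> L, exists y1' y2' y3' x1' x2' : F,
    given_by b' (pres10 r f e q y1' y2' y3' g x1' x2').
Proof.
move=> q0 [bP bT].
pose A1 := - a1 / q; pose A2 := a2 / q; pose A3 := - a3 / q.
pose B1 := - b1 / q; pose B2 := b2 / q; pose B3 := - b3 / q.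
pose b' := basis_of_seqs
  [:: b 'x_1 - A1 *: b 'x_4 - B1 *: b 'x_5;
      b 'x_2 - A2 *: b 'x_4 - B2 *: b 'x_5;
      b 'x_3 - A3 *: b 'x_4 - B3 *: b 'x_5; b 'x_4; b 'x_5]
  [:: b 'y_1; b 'y_2; b 'y_3;
      b 'y_4 + A1 *: b 'y_1 + A2 *: b 'y_2 + A3 *: b 'y_3;
      b 'y_5 + B1 *: b 'y_1 + B2 *: b 'y_2 + B3 *: b 'y_3].
exists b'.
exists (y1 - B2 * a3 - B3 * a2 + A2 * b3 + A3 * b2 + q * (A2 * B3 - A3 * B2)).
exists (y2 + B1 * a3 - B3 * a1 - A1 * b3 + A3 * b1 + q * (A3 * B1 - A1 * B3)).
exists (y3 + B1 * a2 + B2 * a1 - A1 * b2 - A2 * b1 + q * (A1 * B2 - A2 * B1)).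
exists (x1 + A2 * e + A3 * g), (x2 + A3 * r).
split; first by check_standard bP.
have /= cE : forall u,
  (bcoord b' 'x_1 u = bcoord b 'x_1 u) *
  (bcoord b' 'x_2 u = bcoord b 'x_2 u) *
  (bcoord b' 'x_3 u = bcoord b 'x_3 u) *
  (bcoord b' 'y_1 u
   = bcoord b 'y_1 u - A1 * bcoord b 'y_4 u - B1 * bcoord b 'y_5 u) *
  (bcoord b' 'y_2 u
   = bcoord b 'y_2 u - A2 * bcoord b 'y_4 u - B2 * bcoord b 'y_5 u) *
  (bcoord b' 'y_3 u
   = bcoord b 'y_3 u - A3 * bcoord b 'y_4 u - B3 * bcoord b 'y_5 u) *
  (bcoord b' 'y_4 u = bcoord b 'y_4 u) *
  (bcoord b' 'y_5 u = bcoord b 'y_5 u).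
  by move=> u; do !split; rewrite /bcoord /= ?saa_form_lin.
move=> u v w; rewrite bT /psum /= !big_cons !big_nil /det3 /= !cE.
rewrite /A1 /A2 /A3 /B1 /B2 /B3; move: (bcoord b) => c; by field.
Qed.

(** A unipotent change of [x_1], [x_2], [x_3] and the dual change of [y_1],
    [y_2], [y_3] leave the entry [q] alone.  The coefficients [k] and [c] cancel
    [x2] and [x1] against [f], and [m] cancels [g] against [r]. *)
Lemma clear_x (b : sgen -> L) (r f e q y1 y2 y3 g x1 x2 : F) :
    r != 0 -> f != 0 ->
    given_by b (pres10 r f e q y1 y2 y3 g x1 x2) ->
  exists b' : sgen -> L, exists y1' y2' y3' : F,
    given_by b' (pres7 r f e q y1' y2' y3').
Proof.
move=> r0 f0 [bP bT].
pose k := - x2 / f; pose m := (k * e - g) / r; pose c := - (x1 + m * x2) / f.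
pose b' := basis_of_seqs
  [:: b 'x_1 + m *: b 'x_2 + c *: b 'x_3; b 'x_2 + k *: b 'x_3; b 'x_3;
      b 'x_4; b 'x_5]
  [:: b 'y_1; b 'y_2 - m *: b 'y_1;
      b 'y_3 - k *: b 'y_2 + (m * k - c) *: b 'y_1; b 'y_4; b 'y_5].
exists b', y1, (y2 - m * y1), (y3 - k * y2 + (m * k - c) * y1).
split; first by check_standard bP.
have /= cE : forall u,
  (bcoord b' 'x_1 u = bcoord b 'x_1 u) *
  (bcoord b' 'x_2 u = bcoord b 'x_2 u - m * bcoord b 'x_1 u) *
  (bcoord b' 'x_3 u = bcoord b 'x_3 u - k * bcoord b 'x_2 u
                      + (m * k - c) * bcoord b 'x_1 u) *
  (bcoord b' 'y_1 u = bcoord b 'y_1 u + m * bcoord b 'y_2 u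
                      + c * bcoord b 'y_3 u) *
  (bcoord b' 'y_2 u = bcoord b 'y_2 u + k * bcoord b 'y_3 u) *
  (bcoord b' 'y_3 u = bcoord b 'y_3 u) *
  (bcoord b' 'y_4 u = bcoord b 'y_4 u) *
  (bcoord b' 'y_5 u = bcoord b 'y_5 u).
  by move=> u; do !split; rewrite /bcoord /= ?saa_form_lin.
move=> u v w; rewrite bT /psum /= !big_cons !big_nil /det3 /= !cE.
rewrite /c /m /k; move: (bcoord b) => z; by field; rewrite r0 f0.
Qed.

(** Adding [v1 x_1 + v2 x_2] to [y_4] cancels [y2] against [e] and [y3] against
    [r].  Adding [c x_3] to [y_1] cancels [y1] against [f] but forces
    [y_3 + c x_1], which creates the entry [(y_2 y_3, y_5)]; the multiple [d] of
    [y_1] added to [y_5] removes it against [q]. *)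
Lemma clear_y (b : sgen -> L) (r f e q y1 y2 y3 : F) :
    r != 0 -> f != 0 -> e != 0 -> q != 0 ->
    given_by b (pres7 r f e q y1 y2 y3) ->
  exists b' : sgen -> L, given_by b' (pres4 r f e q).
Proof.
move=> r0 f0 e0 q0 [bP bT].
pose v1 := y2 / e; pose v2 := y3 / r; pose c := - y1 / f; pose d := c * e / q.
pose b' := basis_of_seqs
  [:: b 'x_1 - d *: b 'x_5; b 'x_2; b 'x_3; b 'x_4; b 'x_5]
  [:: b 'y_1 + c *: b 'x_3 + v1 *: b 'x_4; b 'y_2 + v2 *: b 'x_4;
      b 'y_3 + c *: b 'x_1; b 'y_4 + v1 *: b 'x_1 + v2 *: b 'x_2;
      b 'y_5 + d *: (b 'y_1 + c *: b 'x_3 + v1 *: b 'x_4)].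
exists b'; split; first by check_standard bP.
have xC i u : '[u, b (inl i)] = - bcoord b (inr i) u by exact: saa_formC.
have /= cE : forall u,
  (bcoord b' 'x_1 u = bcoord b 'x_1 u - c * bcoord b 'y_3 u
                      - v1 * bcoord b 'y_4 u) *
  (bcoord b' 'x_2 u = bcoord b 'x_2 u - v2 * bcoord b 'y_4 u) *
  (bcoord b' 'x_3 u = bcoord b 'x_3 u - c * bcoord b 'y_1 u) *
  (bcoord b' 'y_1 u = bcoord b 'y_1 u - d * bcoord b 'y_5 u) *
  (bcoord b' 'y_2 u = bcoord b 'y_2 u) *
  (bcoord b' 'y_3 u = bcoord b 'y_3 u) *
  (bcoord b' 'y_4 u = bcoord b 'y_4 u) *
  (bcoord b' 'y_5 u = bcoord b 'y_5 u).
  by move=> u; do !split; rewrite /bcoord /= ?saa_form_lin ?xC /bcoord ?mulrN.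
move=> u v w; rewrite bT /psum /= !big_cons !big_nil /det3 /= !cE.
rewrite /d /v1 /v2 /c; move: (bcoord b) => z; field.
by rewrite r0 f0 e0 q0.
Qed.

Lemma normal_form (b : sgen -> L)
    (r f e q y1 y2 y3 g x1 x2 a1 a2 a3 b1 b2 b3 : F) :
    r != 0 -> f != 0 -> e != 0 -> q != 0 ->
    given_by b (pres16 r f e q y1 y2 y3 g x1 x2 a1 a2 a3 b1 b2 b3) ->
  exists2 s : F, s != 0 & exists b' : sgen -> L, given_by b' (P10_2_5 s).
Proof.
move=> r0 f0 e0 q0 /(clear_yyy q0) [b1' [? [? [? [? [?]]]]]].
move=> /(clear_x r0 f0) [b2' [? [? [?]]]].
move=> /(clear_y r0 f0 e0 q0) [b3' b3P].
(* The weights with l_2 = l_3 = 1 that turn q, e and f into 1. *)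
pose l5 := (q * e)^-1.
pose l (i : 'I_5) := [:: q^-1; 1; 1; (f * l5)^-1; l5]`_i.
have l0 : forall i, l i != 0.
  by apply: forall_I5; rewrite /l /= ?oner_eq0 ?invr_eq0 ?mulf_eq0 ?invr_eq0
    ?mulf_eq0 ?negb_or ?q0 ?e0 ?f0.
exists (r * l5); first by rewrite mulf_neq0 ?invr_eq0 ?mulf_neq0.
exists (fun g => dual_weight l g *: b3' g).
have := given_by_scale l0 b3P.
congr (given_by _ _).
rewrite /P10_2_5 /scale_pres /= /l /l5 /=.
congr [:: (_, _); (_, _); (_, _); (_, _)];
  by field; rewrite ?q0 ?e0 ?f0 ?oner_eq0.
Qed.
End NormalForm.

(** * Isomorphisms between the presented algebras *)

Section Isomorphism.
Variable F : fieldType.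

Lemma given_by_iso (L M : saaType F) (f : {linear L -> M}) (b : sgen -> L)
    (P : presentation F) :
    bijective f -> (forall u v, '[f u, f v] = '[u, v]) ->
    (forall u v, f (u *s v) = f u *s f v) -> \dim {:M} = 10%N ->
  given_by b P -> given_by (fun g => f (b g)) P.
Proof.
move=> [f' fK f'K] f_form f_mul dM [bP bT]; split.
  by apply: standard_basisI => // i j; rewrite f_form (saa_form_basis bP).
move=> u v w; rewrite -(f'K u) -(f'K v) -(f'K w) /trip -f_mul f_form.
rewrite -/(trip _ _ _) bT; apply: eq_bigr => e _.
have cE g z : bcoord (fun h => f (b h)) g (f z) = bcoord b g z.
  by case: g => i /=; rewrite f_form.
by rewrite /det3 !cE.
Qed.

Lemma given_by_isomorphic (L M : saaType F) (b : sgen -> L) (c : sgen -> M)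
    (P : presentation F) :
  given_by b P -> given_by c P -> saa_isomorphic L M.
Proof.
move=> [bP bT] [cP cT].
pose f u := \sum_g bcoord b g u *: c g.
pose f' v := \sum_g bcoord c g v *: b g.
have fE g u : bcoord c g (f u) = bcoord b g u by rewrite (bcoord_sum cP).
have f'E g v : bcoord b g (f' v) = bcoord c g v by rewrite (bcoord_sum bP).
have f_lin : linear f.
  move=> a u v; apply: (bcoord_inj cP) => g.
  by rewrite bcoord_lin !fE bcoord_lin.
pose h : {linear L -> M} := HB.pack f (GRing.isLinear.Build _ _ _ _ f f_lin).
have fb g : f (b g) = c g.
  apply: (bcoord_inj cP) => k.
  by rewrite fE (bcoord_basis bP) (bcoord_basis cP).
have f_form u v : '[f u, f v] = '[u, v].
  rewrite (saa_form_coord bP) (saa_form_coord cP).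
  by apply: eq_bigr => i _; rewrite !fE.
have f_trip u v w : trip (f u) (f v) (f w) = trip u v w.
  by rewrite bT cT; apply: eq_bigr => e _; rewrite /det3 !fE.
have f_mul u v : f (u *s v) = f u *s f v.
  apply: (bcoord_inj cP) => g; rewrite fE; case: g => i /=; rewrite -fb.
    by rewrite -/(trip _ _ _) -f_trip.
  by rewrite saa_formC -/(trip _ _ _) -f_trip [RHS]saa_formC.
exists h; split=> //.
  exists f'.
    by move=> u; apply: (bcoord_inj bP) => g; rewrite f'E fE.
  by move=> v; apply: (bcoord_inj cP) => g; rewrite fE f'E.
Qed.
End Isomorphism.

Section Invariants.
Variables (F : fieldType) (L : saaType F).
Implicit Types (A B C : L -> Prop) (u v w : L).

(** [Z1], [Z2], [Z3] are the first terms of the upper central series and [Z6],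
    [Z5], [Z4] their orthogonal complements; [ZU] will be the span of the [x_i].
    They are written in terms of the form and the product alone, so that all
    bases of the algebra compute the same subspaces. *)
Definition perp_pred A u := forall z, A z -> '[z, u] = 0.
Definition kill_pred B C u :=
  forall v w, B v -> C w -> trip u v w = 0.

Definition Z1 := kill_pred (fun=> True) (fun=> True).
Definition Z6 := perp_pred Z1.
Definition Z2 := kill_pred (fun=> True) Z6.
Definition Z5 := perp_pred Z2.
Definition Z3 := kill_pred (fun=> True) Z5.
Definition Z4 := perp_pred Z3.
Definition ZU u := Z4 u /\ kill_pred Z5 Z6 u.

Section InBasis.
Variables (r : F) (b : sgen -> L).
Hypotheses (r_neq0 : r != 0) (bP : given_by b (P10_2_5 r)).
Let bS : standard_basis b := proj1 bP.
Let bT : forall u v w, trip u v w = psum b (P10_2_5 r) u v w := proj2 bP.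

Definition vanish (S : seq sgen) u := all (fun g => bcoord b g u == 0) S.

Lemma vanish_basis S g : vanish S (b g) = (g \notin S).
Proof.
rewrite /vanish; elim: S => //= h S ->.
rewrite (bcoord_basis bS) in_cons negb_or [g == h]eq_sym.
by case: (h == g); rewrite ?oner_eq0 ?eqxx.
Qed.

Definition sdual (g : sgen) : sgen :=
  match g with inl i => inr i | inr i => inl i end.

Lemma perp_vanish A S u : (forall z, A z <-> vanish S z) ->
  perp_pred A u <-> vanish [seq sdual g | g <- sgens & g \notin S] u.
Proof.
move=> AS; split=> [uA|/allP uS z /AS/allP zS].
  apply/allP=> h /mapP[g]; rewrite mem_filter => /andP[gS _] ->.
  have := uA (b g); rewrite AS vanish_basis => /(_ gS) gu.
  move: gu; case: (g) => i /= gu; first by rewrite gu.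
  by rewrite saa_formC gu oppr0.
rewrite (saa_form_coord bS) big1 // => i _.
have zu g : bcoord b g z * bcoord b (sdual g) u = 0.
  case: (boolP (g \in S)) => [/zS/eqP->|gS]; first by rewrite mul0r.
  rewrite (eqP (uS (sdual g) _)) ?mulr0 //.
  by apply: map_f; rewrite mem_filter gS mem_sgens.
by rewrite (zu (inl i)) (zu (inr i)) subrr.
Qed.

Lemma tripE u v w : trip u v w =
  r * det3 b 'x_2 'y_3 'y_5 u v w + det3 b 'x_3 'y_4 'y_5 u v w
  + det3 b 'x_1 'y_2 'y_5 u v w + det3 b 'y_1 'y_2 'y_3 u v w.
Proof.
by rewrite bT /psum !big_cons big_nil /= !mul1r addr0 !addrA.
Qed.

Definition noncentral : seq sgen :=
  [:: 'x_1; 'x_2; 'x_3; 'y_1; 'y_2; 'y_3; 'y_4; 'y_5].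

(** The default value is never reached on [noncentral]. *)
Definition partner (g : sgen) : sgen :=
  match g with
  | inl i => nth 'x_1 [:: 'y_2; 'y_3; 'y_4] i
  | inr i => nth 'x_1 [:: 'y_2; 'y_1; 'y_2; 'x_3; 'y_2] i
  end.

(** Every non-central coordinate of [u] is, up to a nonzero factor, the value of
    the trilinear form at [u] and two generators.  To test that [u] annihilates
    a term of the series, the last of the two has to lie in that term; this is
    what the choice of [partner] provides. *)
Lemma trip_partner g : g \in noncentral ->
  exists h a, a != 0 /\
    forall u, trip u (b h) (b (partner g)) = a * bcoord b g u.
Proof.
have e1 : (1 : F) != 0 by exact: oner_neq0.
have e2 : (- 1 : F) != 0 by rewrite oppr_eq0.
have e3 : - r != 0 by rewrite oppr_eq0.
rewrite !inE => /predU1P[->|/predU1P[->|/predU1P[->|/predU1P[->|/predU1P[->|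
  /predU1P[->|/predU1P[->|/eqP->]]]]]]].
all: [> exists 'y_5, (-1) | exists 'y_5, (-r) | exists 'y_5, (-1)
       | exists 'y_3, (-1) | exists 'y_3, 1 | exists 'y_1, 1
       | exists 'y_5, 1 | exists 'x_1, 1].
all: by split=> // u; rewrite tripE /det3 !(bcoord_basis bS) /=; ring.
Qed.

Lemma vanishP S u :
  reflect (forall g, g \in S -> bcoord b g u = 0) (vanish S u).
Proof. by apply: (iffP allP) => uS g /uS/eqP. Qed.

(** A criterion on generators alone for the determinant of [t] to vanish,
    whatever the middle vector, when the first vector has no coordinate in [K]
    and the last none in [S]. *)
Definition separates (K S : seq sgen) (t : sgen * sgen * sgen) : bool :=
  let: (g, h, k) := t in
  let sep x y := (x \in K) || (y \in S) in
  [&& sep g h, sep g k, sep h g, sep h k, sep k g & sep k h].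

Lemma det3_separates K S g h k u v w :
  separates K S (g, h, k) -> vanish K u -> vanish S w -> det3 b g h k u v w = 0.
Proof.
move=> sep /vanishP uK /vanishP wS.
have uw x y : (x \in K) || (y \in S) -> bcoord b x u * bcoord b y w = 0.
  by case/orP=> [/uK->|/wS->]; rewrite ?mul0r ?mulr0.
have [gh gk hg hk [kg kh]] : [/\ bcoord b g u * bcoord b h w = 0,
  bcoord b g u * bcoord b k w = 0, bcoord b h u * bcoord b g w = 0,
  bcoord b h u * bcoord b k w = 0 & bcoord b k u * bcoord b g w = 0
  /\ bcoord b k u * bcoord b h w = 0].
  by move: sep => /and5P[? ? ? ? /andP[? ?]]; split; [..|split]; exact: uw.
transitivity (bcoord b h v * (bcoord b g u * bcoord b k w)
  - bcoord b k v * (bcoord b g u * bcoord b h w)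
  - bcoord b g v * (bcoord b h u * bcoord b k w)
  + bcoord b k v * (bcoord b h u * bcoord b g w)
  + bcoord b g v * (bcoord b k u * bcoord b h w)
  - bcoord b h v * (bcoord b k u * bcoord b g w)); first by rewrite /det3; ring.
by rewrite gh gk hg hk kg kh; ring.
Qed.

(** Separation gives one inclusion, the partners give the other. *)
Lemma kill_vanish B S K u : (forall v, B v <-> vanish S v) ->
    all (fun g => (g \in noncentral) && (partner g \notin S)) K ->
    all (separates K S) [:: ('x_2, 'y_3, 'y_5); ('x_3, 'y_4, 'y_5);
                            ('x_1, 'y_2, 'y_5); ('y_1, 'y_2, 'y_3)] ->
  kill_pred (fun=> True) B u <-> vanish K u.
Proof.
move=> BS /allP K_read /and5P[s1 s2 s3 s4 _].
split=> [uB|uK v w _ /BS wS]; last first.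
  rewrite tripE (det3_separates _ s1) // (det3_separates _ s2) //.
  by rewrite (det3_separates _ s3) // (det3_separates _ s4) // mulr0 !addr0.
apply/vanishP => g /K_read/andP[/trip_partner[h [a [a0 E]]] kS].
have : trip u (b h) (b (partner g)) = 0.
  by apply: uB => //; apply/BS; rewrite vanish_basis.
by rewrite E => /eqP; rewrite mulf_eq0 (negPf a0) => /eqP.
Qed.

Lemma Z1P u : Z1 u <-> vanish noncentral u.
Proof. exact: (@kill_vanish _ [::]). Qed.
Lemma Z6P u : Z6 u <-> vanish [:: 'y_4; 'y_5] u.
Proof. exact: (perp_vanish _ Z1P). Qed.
Lemma Z2P u : Z2 u <->
  vanish [:: 'x_1; 'x_2; 'y_1; 'y_2; 'y_3; 'y_4; 'y_5] u.
Proof. exact: (kill_vanish _ Z6P). Qed.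
Lemma Z5P u : Z5 u <-> vanish [:: 'y_3; 'y_4; 'y_5] u.
Proof. exact: (perp_vanish _ Z2P). Qed.
Lemma Z3P u : Z3 u <-> vanish [:: 'x_1; 'y_1; 'y_2; 'y_3; 'y_4; 'y_5] u.
Proof. exact: (kill_vanish _ Z5P). Qed.
Lemma Z4P u : Z4 u <-> vanish [:: 'y_2; 'y_3; 'y_4; 'y_5] u.
Proof. exact: (perp_vanish _ Z3P). Qed.
Lemma ZUP u : ZU u <-> vanish [:: 'y_1; 'y_2; 'y_3; 'y_4; 'y_5] u.
Proof.
split=> [[/Z4P/vanishP u4 uK]|uV].
  have y10 : bcoord b 'y_1 u = 0.
    have <- : trip u (b 'y_2) (b 'y_3) = bcoord b 'y_1 u.
      by rewrite tripE /det3 !(bcoord_basis bS) /=; ring.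
    by apply: uK; [apply/Z5P | apply/Z6P]; rewrite vanish_basis.
  by apply/vanishP => g; rewrite in_cons => /predU1P[->|/u4].
move: uV => /vanishP uV; split.
  by apply/Z4P/vanishP => g gV; rewrite uV // in_cons gV orbT.
move=> v w /Z5P/vanishP vV /Z6P/vanishP wV.
rewrite tripE /det3 !(uV (inr _)) // ?(vV 'y_3) ?(vV 'y_4) ?(vV 'y_5) //.
by rewrite ?(wV 'y_4) ?(wV 'y_5) //; ring.
Qed.
End InBasis.

(** Since the two bases compute the same subspaces, the change of basis is
    triangular on [x_1], [x_2], [y_1], [y_2], [y_3].  Two values of the form and
    three of the trilinear form then only involve its diagonal entries, and all
    of these except the one at [x_2] can be eliminated. *)
Lemma same_algebra_cube (r s : F) (b c : sgen -> L) :
    r != 0 -> s != 0 ->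
    given_by b (P10_2_5 r) -> given_by c (P10_2_5 s) ->
  exists2 a, a != 0 & s / r = a ^+ 3.
Proof.
move=> r0 s0 bP cP.
have [bS _] := bP; have [cS cT] := cP.
have /vanishP x1V : vanish b [:: 'y_1; 'y_2; 'y_3; 'y_4; 'y_5] (c 'x_1).
  by apply/(ZUP r0 bP)/(ZUP s0 cP); rewrite (vanish_basis cP).
have /vanishP x2V : vanish b [:: 'x_1; 'y_1; 'y_2; 'y_3; 'y_4; 'y_5] (c 'x_2).
  by apply/(Z3P r0 bP)/(Z3P s0 cP); rewrite (vanish_basis cP).
have /vanishP y1V : vanish b [:: 'y_2; 'y_3; 'y_4; 'y_5] (c 'y_1).
  by apply/(Z4P r0 bP)/(Z4P s0 cP); rewrite (vanish_basis cP).
have /vanishP y2V : vanish b [:: 'y_3; 'y_4; 'y_5] (c 'y_2).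
  by apply/(Z5P r0 bP)/(Z5P s0 cP); rewrite (vanish_basis cP).
have /vanishP y3V : vanish b [:: 'y_4; 'y_5] (c 'y_3).
  by apply/(Z6P r0 bP)/(Z6P s0 cP); rewrite (vanish_basis cP).
pose p g := bcoord b g (c g).
have E1 : p 'x_1 * p 'y_1 = 1.
  have <- : '[c 'x_1, c 'y_1] = 1 by have [_ _ _ ->] := cS.
  rewrite (saa_form_coord bS) sum_I5 /p !(x1V (inr _)) //.
  by rewrite !(y1V 'y_2, y1V 'y_3, y1V 'y_4, y1V 'y_5) //; ring.
have E2 : p 'x_2 * p 'y_2 = 1.
  have <- : '[c 'x_2, c 'y_2] = 1 by have [_ _ _ ->] := cS.
  rewrite (saa_form_coord bS) sum_I5 /p !(x2V 'x_1, x2V (inr _)) //.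
  by rewrite !(y2V 'y_3, y2V 'y_4, y2V 'y_5) //; ring.
have Ey : p 'y_1 * p 'y_2 * p 'y_3 = 1.
  have <- : trip (c 'y_1) (c 'y_2) (c 'y_3) = 1.
    by rewrite (tripE cP) /det3 !(bcoord_basis cS) /=; ring.
  rewrite (tripE bP) /det3 /p !(y1V 'y_2, y1V 'y_3, y1V 'y_4, y1V 'y_5) //.
  by rewrite !(y2V 'y_3, y2V 'y_4, y2V 'y_5, y3V 'y_4, y3V 'y_5) //; ring.
have E5 : p 'x_1 * p 'y_2 * p 'y_5 = 1.
  have <- : trip (c 'x_1) (c 'y_2) (c 'y_5) = 1.
    by rewrite (tripE cP) /det3 !(bcoord_basis cS) /=; ring.
  rewrite (tripE bP) /det3 /p !(x1V (inr _)) //.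
  by rewrite !(y2V 'y_3, y2V 'y_4, y2V 'y_5) //; ring.
have Es : s = r * (p 'x_2 * p 'y_3 * p 'y_5).
  have <- : trip (c 'x_2) (c 'y_3) (c 'y_5) = s.
    by rewrite (tripE cP) /det3 !(bcoord_basis cS) /=; ring.
  rewrite (tripE bP) /det3 /p !(x2V (inr _), x2V 'x_1) //.
  by rewrite !(y3V 'y_4, y3V 'y_5) //; ring.
exists (p 'x_2).
  by apply: contra_eq_neq E2 => ->; rewrite mul0r eq_sym oner_neq0.
rewrite Es mulrAC divff // mul1r.
transitivity ((p 'x_1 * p 'y_1) * (p 'x_2 * p 'y_2) * p 'x_2 * p 'y_3
              * p 'y_5 * (p 'x_2 * p 'y_2)).
  by rewrite E1 E2; ring.
transitivity (p 'x_2 ^+ 3 * (p 'y_1 * p 'y_2 * p 'y_3)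
              * (p 'x_1 * p 'y_2 * p 'y_5)).
  by ring.
by rewrite Ey E5; ring.
Qed.
End Invariants.

Lemma presented_isomorphic (F : fieldType) (r s : F) (L M : saaType F) :
    r != 0 -> s != 0 ->
    presented_by L (P10_2_5 r) -> presented_by M (P10_2_5 s) ->
  saa_isomorphic L M <-> exists2 a : F, a != 0 & s / r = a ^+ 3.
Proof.
move=> r0 s0 /presented_given_by LP /presented_given_by MP.
have [//|b bP] := LP; have [//|c cP] := MP.
have dM := standard_basis_dim (proj1 cP).
split=> [[f [f_bij f_form f_mul]]|[a a0 E]].
  exact: (same_algebra_cube r0 s0 (given_by_iso f_bij f_form f_mul dM bP) cP).
(* The diagonal changes of basis that fix the three entries 1 form a family
   with l_1 = (l_2 l_3)^-1, l_5 = l_1 / l_2, l_4 = l_3 / l_5; here l_2 = a and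
   l_3 = 1. *)
pose l (i : 'I_5) := [:: a^-1; a; 1; a ^+ 2; a^-1 ^+ 2]`_i.
have l0 : forall i, l i != 0.
  by apply: forall_I5; rewrite /l /= ?expf_eq0 ?invr_eq0 ?oner_eq0.
apply: (given_by_isomorphic bP (c := fun g => dual_weight l g *: c g)).
have := given_by_scale l0 cP; congr (given_by _ _).
have -> : s = r * a ^+ 3 by rewrite -E mulrC divfK.
rewrite /P10_2_5 /scale_pres /= /l /=.
by congr [:: (_, _); (_, _); (_, _); (_, _)]; field; rewrite ?a0 ?oner_eq0.
Qed.

(** * Orthogonal complements *)

Section Perp.
Variables (F : fieldType) (L : saaType F).
Implicit Types (u v w : L) (U V W : {vspace L}).

(** By non-degeneracy the Gram matrix of [X] against a basis of [L] has
    independent rows, hence a right inverse. *)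
Lemma form_dual n (X : n.-tuple L) : free X ->
  exists y : 'I_n -> L, forall i j : 'I_n, '[X`_i, y j] = (i == j)%:R.
Proof.
move=> Xfree; pose B := vbasis {:L}.
pose G := \matrix_(i < n, j < \dim {:L}) '[X`_i, B`_j].
have /row_freeP[P GP] : row_free G.
  apply: inj_row_free => c cG; apply/rowP => i; rewrite mxE.
  have : \sum_i c 0 i *: X`_i = 0.
    apply: saa_form_nondeg => v; rewrite (coord_vbasis (memvf v)).
    rewrite saa_form_sumr big1 // => j _; rewrite saa_form_lin.
    suff -> : '[\sum_i c 0 i *: X`_i, B`_j] = (c *m G) 0 j.
      by rewrite cG mxE mulr0.
    rewrite saa_form_suml mxE; apply: eq_bigr => k _.
    by rewrite saa_form_lin mxE.
  by move/freeP: Xfree => /(_ (fun i => c 0 i)) H /H.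
exists (fun j => \sum_k P k j *: B`_k) => i j.
transitivity ((G *m P) i j); last by rewrite GP mxE.
rewrite saa_form_sumr mxE; apply: eq_bigr => k _.
by rewrite saa_form_lin mxE mulrC.
Qed.

(** A dual family is corrected by vectors of the span of [X].  Only the entries
    of its Gram matrix above the diagonal are used, so that nothing has to be
    divided by 2. *)
Lemma isotropic_extend n (X : n.-tuple L) : free X ->
    (forall i j : 'I_n, '[X`_i, X`_j] = 0) ->
  exists y : 'I_n -> L, (forall i j : 'I_n, '[X`_i, y j] = (i == j)%:R) /\
    (forall i j, '[y i, y j] = 0).
Proof.
move=> Xfree Xiso; have [z Xz] := form_dual Xfree.
pose c (i j : 'I_n) := if (i < j)%N then - '[z i, z j] else 0.
exists (fun i => z i + \sum_k c i k *: X`_k); split=> i j.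
  rewrite saa_form_lin Xz saa_form_sumr big1 ?addr0 // => k _.
  by rewrite saa_form_lin Xiso mulr0.
have zX (k l : 'I_n) : '[z k, X`_l] = - (l == k)%:R by rewrite saa_formC Xz.
have S1 k : '[z i, \sum_l c k l *: X`_l] = - c k i.
  rewrite saa_form_sumr (bigD1 i) //= saa_form_lin zX eqxx mulrN1.
  rewrite big1 ?addr0 //.
  by move=> l /negPf li; rewrite saa_form_lin zX li oppr0 mulr0.
have S2 k : '[\sum_l c k l *: X`_l, z j] = c k j.
  rewrite saa_form_suml (bigD1 j) //= saa_form_lin Xz eqxx mulr1 big1 ?addr0 //.
  by move=> l /negPf lj; rewrite saa_form_lin Xz lj mulr0.
have S3 : '[\sum_l c i l *: X`_l, \sum_l c j l *: X`_l] = 0.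
  rewrite saa_form_suml big1 // => k _; rewrite saa_form_sumr big1 // => l _.
  by rewrite !saa_form_lin Xiso !mulr0.
rewrite !saa_form_lin S1 S2 S3 addr0 /c.
have [ij|ji|/val_inj->] := ltngtP i j.
- by rewrite oppr0 addr0 addrN.
- by rewrite addr0 opprK saa_formC addNr.
by rewrite saa_form_alt oppr0 !addr0.
Qed.

Definition form_row n (X : n.-tuple L) v : 'rV[F]_n := \row_i '[X`_i, v].
Lemma form_row_linear n (X : n.-tuple L) : linear (form_row X).
Proof. by move=> a u v; apply/rowP => i; rewrite !mxE !saa_form_lin. Qed.
HB.instance Definition _ n (X : n.-tuple L) :=
  GRing.isLinear.Build _ _ _ _ (form_row X) (form_row_linear X).

Definition perp U : {vspace L} := lker (linfun (form_row (vbasis U))).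

Lemma perpP U v : reflect (forall u, u \in U -> '[u, v] = 0) (v \in perp U).
Proof.
rewrite memv_ker lfunE /=; apply: (iffP eqP) => [/rowP v0 u /coord_vbasis->|v0].
  rewrite saa_form_suml big1 // => i _; rewrite saa_form_lin.
  by have := v0 i; rewrite !mxE => ->; rewrite mulr0.
by apply/rowP => i; rewrite !mxE v0 ?vbasis_mem ?memt_nth.
Qed.

Lemma dim_perp U : (\dim (perp U) + \dim U)%N = \dim {:L}.
Proof.
have := limg_ker_dim (linfun (form_row (vbasis U))) {:L}.
rewrite capfv -/(perp U) => <-; congr (_ + _)%N.
suff -> : (linfun (form_row (vbasis U)) @: fullv)%VS = fullv.
  by rewrite dimvf dim_matrix mul1r.
apply/eqP; rewrite eqEsubv subvf; apply/subvP => w _.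
have [y Xy] := form_dual (basis_free (vbasisP U)).
apply/memv_imgP; exists (\sum_j w 0 j *: y j); first exact: memvf.
rewrite lfunE; apply/rowP => i; rewrite mxE saa_form_sumr (bigD1 i) //=.
rewrite saa_form_lin Xy eqxx mulr1 big1 ?addr0 // => j /negPf ji.
by rewrite saa_form_lin Xy eq_sym ji mulr0.
Qed.

Lemma vs_pick U V : (\dim U < \dim V)%N -> exists2 x, x \in V & x \notin U.
Proof.
move=> ltUV; apply/subvPn; apply: contraL ltUV => /dimvS; by rewrite -leqNgt.
Qed.

Lemma vs_split U V x : (U <= V)%VS -> (\dim V <= (\dim U).+1)%N -> x \in V ->
  x \notin U -> forall v, v \in V -> exists a u, u \in U /\ v = a *: x + u.
Proof.
move=> sUV dV xV xU v vV.
have : v \in (U + <[x]>)%VS.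
  suff -> : (U + <[x]>)%VS = V by [].
  apply/eqP; rewrite eqEdim subv_add sUV -memvE xV /=.
  apply: leq_trans dV _; rewrite ltn_neqAle dimvS ?addvSl // andbT.
  apply: contra xU; rewrite memvE => dE.
  apply: subv_trans (addvSr U _) _.
  have := eqEdim U (U + <[x]>)%VS.
  by rewrite addvSl -(eqP dE) leqnn => /eqP {2}->.
case/memv_addP => u uU [_ /vlineP[a ->] ->].
by exists a, u; rewrite addrC.
Qed.
End Perp.

(** * The lower central series *)

Section LowerCentral.
Variables (F : fieldType) (L : saaType F).
Implicit Types (u v w : L) (U V W : {vspace L}).
Local Notation lcs := (saa_lcs L).

Lemma lcsS m : lcs m.+2 = saa_prodv (lcs m.+1) fullv.
Proof. by []. Qed.

Lemma mul_lcs m u v : u \in lcs m.+1 -> u *s v \in lcs m.+2.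
Proof. by move=> um; rewrite lcsS mem_saa_prodv ?memvf. Qed.

Lemma mul_lcs_r m u v : v \in lcs m.+1 -> u *s v \in lcs m.+2.
Proof. by move=> vm; rewrite saa_mulC memvN mul_lcs. Qed.

Lemma lcs_sub1 m : (lcs m.+2 <= lcs m.+1)%VS.
Proof.
elim: m => [|m IH]; first exact: subvf.
rewrite lcsS; apply/saa_prodvP => u v uU _.
by rewrite mul_lcs // (subvP IH).
Qed.

Lemma lcs_sub m n : (m <= n)%N -> (lcs n.+1 <= lcs m.+1)%VS.
Proof.
move=> /subnKC<-; elim: (n - m)%N => [|k IH]; first by rewrite addn0.
by rewrite addnS (subv_trans (lcs_sub1 _)).
Qed.

Lemma saa_form_mulr w u v : '[w, u *s v] = - '[w *s u, v].
Proof. by rewrite saa_formC -[saa_form _ _ _]/(trip u v w) 2!trip_cyc. Qed.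

(** Multiplication by an element of [L] is self-adjoint for the form, so the
    factor [L] passes from one side of an orthogonality to the other. *)
Lemma perp_prodv U v :
  v \in perp (saa_prodv U fullv) <-> (forall u, u *s v \in perp U).
Proof.
split=> [/perpP vP u|vP].
  apply/perpP => w wU.
  by rewrite saa_form_mulr vP ?oppr0 // mem_saa_prodv ?memvf.
have : (saa_prodv U fullv <= perp <[v]>)%VS.
  apply/saa_prodvP => w u wU _; apply/perpP => _ /vlineP[a ->].
  rewrite saa_form_lin saa_formC -[- _]saa_form_mulr.
  by have /perpP -> := vP u; rewrite ?mulr0.
move=> /subvP sub; apply/perpP => w /sub/perpP/(_ v (memv_line v)).
by rewrite saa_formC => /eqP; rewrite oppr_eq0 => /eqP.
Qed.

Lemma perp_lcs2 : perp (lcs 2) = saa_center L.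
Proof.
apply/vspaceP => v; apply/idP/idP.
  move/perp_prodv => vP; apply/saa_centerP => u; apply: saa_form_nondeg => w.
  by rewrite saa_mulC saa_form_lin saa_formC; have /perpP -> := vP u;
    rewrite ?memvf ?oppr0.
move/saa_centerP => v0; apply/perp_prodv => u.
by rewrite saa_mulC v0 oppr0 mem0v.
Qed.

(** Factors [L] are moved one at a time to the left, until the right side is
    [L] itself. *)
Lemma orth_lcs i j u v : lcs (i + j).+1 = 0%VS ->
  u \in lcs i.+1 -> v \in lcs j.+1 -> '[u, v] = 0.
Proof.
move=> ij0 ui; suff: (lcs j.+1 <= perp (lcs i.+1))%VS.
  by move=> /subvP sub /sub/perpP; apply.
elim: j i {u ui} ij0 => [|j IH] i.
  rewrite addn0 => ->; apply/subvP => w _; apply/perpP => u.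
  by rewrite memv0 => /eqP ->; rewrite saa_form_lin.
rewrite addnS -addSn => /IH sub; apply/saa_prodvP => w u wj _.
rewrite saa_mulC memvN; apply: (iffLR (perp_prodv _ _)).
exact: (subvP sub).
Qed.

Lemma trip_lcs i j u v w : lcs (i + j).+2 = 0%VS ->
  u \in lcs i.+1 -> v \in lcs j.+1 -> trip u v w = 0.
Proof.
move=> ij0 ui vj; rewrite trip_cyc trip_cyc /trip.
apply: (@orth_lcs i.+1 j _ _ _ _ vj); first by rewrite addSn.
exact: mul_lcs_r.
Qed.

Lemma mul_eq0P u v : u *s v = 0 <-> forall w, trip u v w = 0.
Proof.
split=> [uv w|uv]; first by rewrite /trip uv saa_form_lin.
exact: saa_form_nondeg.
Qed.

Lemma mul_lcs_eq0 i j u v : lcs (i + j).+2 = 0%VS ->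
  u \in lcs i.+1 -> v \in lcs j.+1 -> u *s v = 0.
Proof. by move=> ij ui vj; apply/mul_eq0P => w; apply: trip_lcs ij ui vj. Qed.

(** A repetition would make the series stationary before it reaches 0. *)
Lemma dim_lcs_lt m n : lcs n.+1 = 0%VS -> lcs m.+2 != 0%VS ->
  (\dim (lcs m.+2) < \dim (lcs m.+1))%N.
Proof.
move=> n0 m0; rewrite ltn_neqAle dimvS ?lcs_sub1 // andbT.
apply: contra m0 => /eqP dE.
have E : lcs m.+2 = lcs m.+1 by apply/eqP; rewrite eqEdim lcs_sub1 dE leqnn.
have stab k : lcs (m + k).+1 = lcs m.+1.
  elim: k => [|k IH]; first by rewrite addn0.
  by rewrite addnS lcsS IH -lcsS E.
rewrite E; apply/eqP; case: (leqP m n) => [/subnKC mn|/ltnW nm].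
  by rewrite -(stab (n - m)%N) mn.
by apply/eqP; rewrite -subv0 -n0 lcs_sub.
Qed.
End LowerCentral.

(** * Class 7, dimension 10 and center of dimension 2 *)

Section Structure.
Variables (F : fieldType) (L : saaType F).
Implicit Types (u v w : L) (U V W : {vspace L}).
Local Notation lcs := (saa_lcs L).
Hypotheses (dimL : \dim {:L} = 10%N) (dimZ : \dim (saa_center L) = 2%N)
  (classL : saa_class L 7).

Let lcs8 : lcs 8 = 0%VS := proj1 classL.

Let lcs_eq0 n : (7 <= n)%N -> lcs n.+1 = 0%VS.
Proof. by move=> n7; apply/eqP; rewrite -subv0 -lcs8 lcs_sub. Qed.

Let lcs_neq0 n : (n <= 6)%N -> lcs n.+1 != 0%VS.
Proof. by move=> n6; apply/eqP => /(proj2 classL); rewrite leqNgt ltnS n6. Qed.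

Let lcs_lt n : (n <= 5)%N -> (\dim (lcs n.+2) < \dim (lcs n.+1))%N.
Proof. by move=> n5; apply: dim_lcs_lt lcs8 _; apply: lcs_neq0. Qed.

(** Indices are shifted by one, [i] standing for [L^(i + 1)]; this avoids the
    meaningless [saa_lcs L 0]. *)
Let lcs_orth i j u v : (7 <= i + j)%N ->
  u \in lcs i.+1 -> v \in lcs j.+1 -> '[u, v] = 0.
Proof. by move=> ij; apply: orth_lcs; apply: lcs_eq0. Qed.

Let lcs_trip i j u v w : (6 <= i + j)%N ->
  u \in lcs i.+1 -> v \in lcs j.+1 -> trip u v w = 0.
Proof. by move=> ij; apply: trip_lcs; apply: lcs_eq0. Qed.

Let lcs_mul i j u v : (6 <= i + j)%N ->
  u \in lcs i.+1 -> v \in lcs j.+1 -> u *s v = 0.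
Proof. by move=> ij; apply: mul_lcs_eq0; apply: lcs_eq0. Qed.

Let lcs_perp i j : (7 <= i + j)%N -> (lcs i.+1 <= perp (lcs j.+1))%VS.
Proof.
move=> ij; apply/subvP => u ui; apply/perpP => v vj.
by apply: (lcs_orth _ vj ui); rewrite addnC.
Qed.

Lemma dim_lcs2 : \dim (lcs 2) = 8%N.
Proof. by have := dim_perp (lcs 2); rewrite perp_lcs2 dimZ dimL; lia. Qed.

Lemma two_generators : exists a b : L, forall v,
  exists x y u, u \in lcs 2 /\ v = x *: a + (y *: b + u).
Proof.
have [b _ b2] : exists2 b, b \in {:L}%VS & b \notin lcs 2.
  by apply: vs_pick; rewrite dim_lcs2 dimL.
pose W := (lcs 2 + <[b]>)%VS.
have dW : (\dim W <= 9)%N.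
  apply: leq_trans (dimv_add_leqif _ _).1 _.
  by rewrite dim_lcs2 dim_vline; case: eqP.
have dW' : (9 <= \dim W)%N.
  rewrite ltnNge; apply: contra b2 => dW8.
  have -> : lcs 2 = W by apply/eqP; rewrite eqEdim addvSl dim_lcs2.
  by rewrite memvE addvSr.
have [a _ aW] : exists2 a, a \in {:L}%VS & a \notin W.
  by apply: vs_pick; rewrite dimL.
exists a, b => v.
have dLW : (\dim {:L} <= (\dim W).+1)%N by rewrite dimL.
have [x [w [wW ->]]] := vs_split (subvf W) dLW (memvf a) aW (memvf v).
case/memv_addP: wW => u u2 [_ /vlineP[y ->] ->].
by exists x, y, u; rewrite [u + _]addrC.
Qed.

(** With [a] and [b] generating [L] modulo [L^2], all products are multiples of
    [a b] modulo [L^3]. *)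
Lemma dim_lcs3 : \dim (lcs 3) = 7%N.
Proof.
have lt32 := lcs_lt (isT : (1 <= 5)%N); rewrite dim_lcs2 in lt32.
have [a [b ab]] := two_generators.
have sub : (lcs 2 <= <[a *s b]> + lcs 3)%VS.
  apply/saa_prodvP => v w _ _.
  have [x [y [u [u2 vE]]]] := ab v; have [x' [y' [u' [u2' wE]]]] := ab w.
  have -> : v *s w = (x * y' - y * x') *: (a *s b)
                     + (u *s w + (x *: a + y *: b) *s u').
    set p := x *: a + y *: b; set p' := x' *: a + y' *: b.
    have <- : p *s p' = (x * y' - y * x') *: (a *s b).
      rewrite !saa_mul_lin !saa_mul_alt (saa_mulC b a) !scaler0 add0r addr0.
      by rewrite !scalerN !scalerA scalerBl.
    have pw : p *s w = p *s p' + p *s u' by rewrite wE addrA saa_mulDr.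
    by rewrite vE addrA -/p saa_mulDl pw -addrA [p *s u' + _]addrC.
  by apply: memv_add; [exact: memvZ (memv_line _) | apply: rpredD;
    [exact: mul_lcs | exact: mul_lcs_r]].
have := dimvS sub; have := (dimv_add_leqif <[a *s b]> (lcs 3)).1.
have : (\dim <[a *s b]> <= 1)%N by rewrite dim_vline; case: eqP.
by rewrite dim_lcs2; lia.
Qed.

(** As [x L^2 = 0] and [x] is not central, [(x a, b) <> 0] for generators [a]
    and [b].  The vectors [x a] and [x b] of [L^7] then detect the component of
    a vector outside [L^2]. *)
Lemma dim_perp_lcs7 x : x \in lcs 6 -> x \notin saa_center L ->
  (\dim (perp (lcs 7)) <= 8)%N.
Proof.
move=> x6 xZ; have [a [b ab]] := two_generators.
have x2 u w : u \in lcs 2 -> trip x u w = 0.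
  by apply: (lcs_trip (i := 5) (j := 1)).
have xab : trip x a b != 0.
  apply: contra xZ => /eqP xab; apply/saa_centerP => v; apply/mul_eq0P => w.
  have xba : trip x b a = 0 by rewrite tripCr xab oppr0.
  have xaa c : trip x c c = 0 by rewrite trip_cyc trip_alt.
  have x2' c u : u \in lcs 2 -> trip x c u = 0.
    by move=> u2; rewrite tripCr x2 ?oppr0.
  have [s [t [u [u2 ->]]]] := ab v; have [s' [t' [u' [u2' ->]]]] := ab w.
  rewrite /trip !(saa_mul_lin, saa_form_lin) -!/(trip _ _ _) xab xba !xaa.
  by rewrite !(x2 _ _ u2) !(x2' _ _ u2') !(mulr0, addr0).
rewrite -dim_lcs2; apply: dimvS; apply/subvP => v /perpP v7.
have xv c : trip x c v = 0 by rewrite /trip v7 // mul_lcs.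
have [s [t [u [u2 vE]]]] := ab v.
have xcu c : trip x c u = 0 by rewrite tripCr x2 ?oppr0.
have t0 : t = 0.
  have := xv a; rewrite vE /trip !saa_form_lin -!/(trip _ _ _) xcu trip_cyc.
  rewrite trip_alt mulr0 add0r addr0 => /eqP.
  by rewrite mulf_eq0 (negPf xab) orbF => /eqP.
have s0 : s = 0.
  have := xv b; rewrite vE /trip !saa_form_lin -!/(trip _ _ _) xcu tripCr.
  rewrite [trip x b b]trip_cyc trip_alt mulr0 !addr0 mulrN => /eqP.
  by rewrite oppr_eq0 mulf_eq0 (negPf xab) orbF => /eqP.
by rewrite vE s0 t0 !scale0r !add0r.
Qed.

Lemma lcs7_center : lcs 7 = saa_center L.
Proof.
have sub : (lcs 7 <= saa_center L)%VS.
  apply/subvP => v v7; apply/saa_centerP => w; apply/eqP.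
  by rewrite -memv0 -lcs8 mul_lcs.
have [x x6 xZ] : exists2 x, x \in lcs 6 & x \notin saa_center L.
  apply/subvPn; apply: contra (lcs_neq0 (isT : (6 <= 6)%N)) => /subvP s6.
  rewrite -subv0; apply/saa_prodvP => u v /s6/saa_centerP -> _; exact: mem0v.
apply/eqP; rewrite eqEdim sub dimZ /=.
by have := dim_perp_lcs7 x6 xZ; have := dim_perp (lcs 7); rewrite dimL; lia.
Qed.

(** Orthogonality and strict descent leave the dimensions (6, 4) and (5, 4) for
    [L^4] and [L^5].  In the second case [L^5] would be a hyperplane of [L^4]
    orthogonal to it, so [L^4] would be isotropic; moving a factor [L] across,
    [L^5] would be orthogonal to [L^3], whose complement has dimension 3. *)
Lemma dim_lcs : [/\ \dim (lcs 4) = 6%N, \dim (lcs 5) = 4%N, \dim (lcs 6) = 3%N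
  & \dim (lcs 7) = 2%N].
Proof.
have d7 : \dim (lcs 7) = 2%N by rewrite lcs7_center.
have d3 := dim_lcs3.
have lt n (n5 : (n <= 5)%N) := lcs_lt n5.
have d36 : (\dim (lcs 6) + \dim (lcs 3) <= 10)%N.
  by rewrite -dimL -(dim_perp (lcs 3)) leq_add2r dimvS // lcs_perp.
have d45 : (\dim (lcs 5) + \dim (lcs 4) <= 10)%N.
  by rewrite -dimL -(dim_perp (lcs 4)) leq_add2r dimvS // lcs_perp.
have lt4 : (\dim (lcs 4) < \dim (lcs 3))%N := lt 2 isT.
have lt5 : (\dim (lcs 5) < \dim (lcs 4))%N := lt 3 isT.
have lt6 : (\dim (lcs 6) < \dim (lcs 5))%N := lt 4 isT.
have lt7 : (\dim (lcs 7) < \dim (lcs 6))%N := lt 5 isT.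
suff d5 : \dim (lcs 4) <> 5%N by split=> //; lia.
move=> d4.
have [x x4 x5] : exists2 x, x \in lcs 4 & x \notin lcs 5 by apply: vs_pick.
have iso4 u v : u \in lcs 4 -> v \in lcs 4 -> '[u, v] = 0.
  have d45' : (\dim (lcs 4) <= (\dim (lcs 5)).+1)%N by lia.
  have split4 := vs_split (lcs_sub1 L 3) d45' x4 x5.
  move=> u4 v4; have [c [w [w5 ->]]] := split4 u u4.
  have [d [z [z5 ->]]] := split4 v v4.
  rewrite !saa_form_lin saa_form_alt (@lcs_orth 4 4 w z) //.
  by rewrite (@lcs_orth 4 3 w x) // (@lcs_orth 3 4 x z) // !mulr0 !addr0.
have : (lcs 5 <= perp (lcs 3))%VS.
  apply/saa_prodvP => v u v4 _; rewrite saa_mulC memvN.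
  apply: (iffLR (perp_prodv _ _)); apply/perpP => w w4; exact: iso4.
by move/dimvS; have := dim_perp (lcs 3); rewrite dimL; lia.
Qed.
Lemma perp_lcs_eq i j : (7 <= i + j)%N ->
  (\dim (lcs i.+1) + \dim (lcs j.+1))%N = 10%N -> lcs i.+1 = perp (lcs j.+1).
Proof.
move=> ij dij; apply/eqP; rewrite eqEdim lcs_perp //=.
by have := dim_perp (lcs j.+1); rewrite dimL; lia.
Qed.

(** The term of the lower central series in which a generator of the adapted
    basis lies; for [y_4] and [y_5] it is [L] itself. *)
Definition level (g : sgen) : nat :=
  match g with
  | inl i => nth 0%N [:: 4; 5; 6; 7; 7] i
  | inr i => nth 0%N [:: 4; 3; 2; 1; 1] i
  end.

Hypothesis L4L3_neq : saa_prodv (lcs 4) (lcs 3) <> lcs 7.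
Hypothesis L5L2_sub :
  (saa_prodv (lcs 5) (lcs 2) <= saa_prodv (lcs 4) (lcs 3))%VS.
Hypothesis dimUL2 :
  \dim (saa_prodv (saa_transporter (lcs 4) (lcs 3) (saa_prodv (lcs 5) (lcs 2)))
          (lcs 2)) = 1%N.

(** The vector [x5] spans [L^5 L^2].  Since [L^4 L^4 = 0], every element of
    [L^4 L^3] is a product [x y2] with [x] in [L^4] and [y2] fixed in [L^3]
    outside [L^4]; as [L^5 L^2 <= L^4 L^3], some [x1] has [x1 y2 = x5].  Then
    [x1 L^3 <= L^5 L^2], that is [x1] lies in [U], whose product with [L^2] is
    the line of [x5]. *)
Lemma adapted_vectors : exists x1 x2 x3 x4 x5 : L,
  [/\ [/\ x1 \in lcs 4 /\ x1 \notin lcs 5, x2 \in lcs 5 /\ x2 \notin lcs 6,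
          x3 \in lcs 6 /\ x3 \notin lcs 7, x4 \in lcs 7 /\ x4 \notin <[x5]>%VS
        & x5 \in lcs 7 /\ x5 != 0],
      x5 \in saa_prodv (lcs 4) (lcs 3),
      exists2 z, z \in lcs 3 & x1 *s z = x5,
      exists2 z, z \in lcs 2 & x2 *s z = x5
    & forall u, u \in lcs 2 -> x1 *s u \in <[x5]>%VS /\ x2 *s u \in <[x5]>%VS].
Proof.
have d2 := dim_lcs2; have d3 := dim_lcs3; have [d4 d5 d6 d7] := dim_lcs.
have [y3 y32 y33] : exists2 y, y \in lcs 2 & y \notin lcs 3.
  by apply: vs_pick; rewrite d2 d3.
have [y2 y23 y24] : exists2 y, y \in lcs 3 & y \notin lcs 4.
  by apply: vs_pick; rewrite d3 d4.
have [x2 x25 x26] : exists2 x, x \in lcs 5 & x \notin lcs 6.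
  by apply: vs_pick; rewrite d5 d6.
have [x3 x36 x37] : exists2 x, x \in lcs 6 & x \notin lcs 7.
  by apply: vs_pick; rewrite d6 d7.
have dS2 : (\dim (lcs 2) <= (\dim (lcs 3)).+1)%N by rewrite d2 d3.
have dS3 : (\dim (lcs 3) <= (\dim (lcs 4)).+1)%N by rewrite d3 d4.
have dS5 : (\dim (lcs 5) <= (\dim (lcs 6)).+1)%N by rewrite d5 d6.
have split2 := vs_split (lcs_sub1 L 1) dS2 y32 y33.
have split3 := vs_split (lcs_sub1 L 2) dS3 y23 y24.
have split5 := vs_split (lcs_sub1 L 4) dS5 x25 x26.
pose x5 := x2 *s y3.
have x2_mul u : u \in lcs 2 -> exists c, x2 *s u = c *: x5.
  move=> /split2[c [w [w3 ->]]]; exists c.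
  by rewrite !saa_mul_lin (lcs_mul (i := 4) (j := 2) _ x25 w3) // addr0.
have x57 : x5 \in lcs 7.
  rewrite lcs7_center -perp_lcs2; apply/perpP => _ /split2[c [w [w3 ->]]].
  rewrite saa_formC !saa_form_lin -!/(trip _ _ _) [trip _ y3 y3]trip_cyc.
  rewrite trip_alt tripCr (lcs_trip (i := 4) (j := 2) _ _ x25 w3) //.
  by rewrite mulr0 !oppr0 addr0 oppr0.
have x50 : x5 != 0.
  apply: contraNneq x37 => x50; suff /subvP : (lcs 6 <= lcs 7)%VS by apply.
  rewrite [X in (_ <= X)%VS]lcs7_center -perp_lcs2.
  apply/saa_prodvP => v w v5 _.
  apply/perpP => z z2; rewrite saa_form_mulr saa_mulC.
  suff -> : v *s z = 0 by rewrite !saa_form_lin !oppr0.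
  have [c [u [u6 ->]]] := split5 v v5; have [e E] := x2_mul z z2.
  rewrite !saa_mul_lin E x50 !scaler0 add0r.
  exact: (lcs_mul (i := 5) (j := 1) _ u6 z2).
have L5L2 : (saa_prodv (lcs 5) (lcs 2) <= <[x5]>)%VS.
  apply/saa_prodvP => v w /split5[c [u [u6 ->]]] w2.
  have [e E] := x2_mul w w2.
  rewrite !saa_mul_lin E (lcs_mul (i := 5) (j := 1) _ u6 w2) // addr0.
  by rewrite !memvZ ?memv_line.
have x5_L5L2 : x5 \in saa_prodv (lcs 5) (lcs 2) by exact: mem_saa_prodv.
have x5_L4L3 : x5 \in saa_prodv (lcs 4) (lcs 3) := subvP L5L2_sub _ x5_L5L2.
have [x1 x14 x1y2] : exists2 x1, x1 \in lcs 4 & x1 *s y2 = x5.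
  have sub : (saa_prodv (lcs 4) (lcs 3)
              <= linfun (applyr (saa_mul L) y2) @: lcs 4)%VS.
    apply/saa_prodvP => v w v4 /split3[c [u [u4 ->]]].
    rewrite !saa_mul_lin (lcs_mul (i := 3) (j := 3) _ v4 u4) // addr0.
    rewrite -saa_mulZl; apply/memv_imgP; exists (c *: v); first exact: memvZ.
    by rewrite lfunE.
  have /memv_imgP[x1 x14 E] := subvP sub _ x5_L4L3.
  by exists x1; rewrite // E lfunE.
have x15 : x1 \notin lcs 5.
  apply: contra x50 => x15; rewrite -x1y2.
  by rewrite (lcs_mul (i := 4) (j := 2) _ x15 y23).
pose U := saa_transporter (lcs 4) (lcs 3) (saa_prodv (lcs 5) (lcs 2)).
have x1U : x1 \in U.
  rewrite mem_saa_transporter x14; apply/saa_prodvP => _ w /vlineP[c ->].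
  case/split3 => e [u [u4 ->]].
  rewrite !saa_mul_lin x1y2 (lcs_mul (i := 3) (j := 3) _ x14 u4) //.
  rewrite scaler0 addr0.
  by rewrite !memvZ.
have x2U : x2 \in U.
  rewrite mem_saa_transporter (subvP (lcs_sub1 L 3)) //.
  apply/saa_prodvP => _ w /vlineP[c ->] w3.
  by rewrite saa_mul_lin (lcs_mul (i := 4) (j := 2) _ x25 w3) // scaler0 mem0v.
have UL2 : saa_prodv U (lcs 2) = <[x5]>%VS.
  apply/esym/eqP; rewrite eqEdim dimUL2 dim_vline x50 andbT -memvE.
  exact: mem_saa_prodv.
have [x4 x47 x45] : exists2 x, x \in lcs 7 & x \notin <[x5]>%VS.
  by apply: vs_pick; rewrite d7 dim_vline; case: eqP.
exists x1, x2, x3, x4, x5; split=> //.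
- by exists y2.
- by exists y3.
by move=> u u2; rewrite -UL2; split; apply: mem_saa_prodv.
Qed.

(** The [x_i] are isotropic because [L^i] and [L^j] are orthogonal for
    [i + j >= 9], and each [y_i] falls into the right term because
    [L^(9 - i)] is all of the orthogonal complement of [L^i]. *)
Lemma adapted_basis : exists b : sgen -> L,
  [/\ standard_basis b, forall g, b g \in lcs (level g),
      b 'x_5 \in saa_prodv (lcs 4) (lcs 3)
    & [/\ forall u, u \in lcs 2 ->
            b 'x_1 *s u \in <[b 'x_5]>%VS /\ b 'x_2 *s u \in <[b 'x_5]>%VS,
          trip (b 'x_1) (b 'y_2) (b 'y_5) != 0
        & trip (b 'x_2) (b 'y_3) (b 'y_5) != 0]].
Proof.
have [x1 [x2 [x3 [x4 [x5]]]]] := adapted_vectors.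
case=> -[[x14 x15] [x25 x26] [x36 x37] [x47 x45] [x57 x50]] x5m.
move=> [z2 z23 x1z2] [z3 z32 x2z3] x12m.
have d2 := dim_lcs2; have d3 := dim_lcs3; have [d4 d5 d6 d7] := dim_lcs.
pose X := [tuple x1; x2; x3; x4; x5].
have X_level (i : 'I_5) : X`_i \in lcs (level (inl i)).
  by move: i; apply: forall_I5.
have Xfree : free X.
  rewrite /= !free_cons nil_free span_nil memv0 x50 !andbT.
  have s5 : (<<[:: x5]>> <= lcs 7)%VS by rewrite span_seq1 -memvE.
  have s4 : (<<[:: x4; x5]>> <= lcs 7)%VS.
    by rewrite span_cons subv_add -memvE x47.
  have s3 : (<<[:: x3; x4; x5]>> <= lcs 6)%VS.
    by rewrite span_cons subv_add -memvE x36 (subv_trans s4) ?lcs_sub1.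
  have s2 : (<<[:: x2; x3; x4; x5]>> <= lcs 5)%VS.
    by rewrite span_cons subv_add -memvE x25 (subv_trans s3) ?lcs_sub1.
  rewrite (contra (subvP s2 x1) x15) (contra (subvP s3 x2) x26).
  by rewrite (contra (subvP s4 x3) x37) span_seq1 x45.
have Xiso (i j : 'I_5) : '[X`_i, X`_j] = 0.
  have [->|ij] := eqVneq i j; first exact: saa_form_alt.
  have lev : (9 <= level (inl i) + level (inl j))%N.
    by move: i j ij; do 2![apply: forall_I5].
  have lev0 (k : 'I_5) : level (inl k) = (level (inl k)).-1.+1.
    by move: k; apply: forall_I5.
  apply: (@lcs_orth (level (inl i)).-1 (level (inl j)).-1); last 2 first.
  - by rewrite -lev0.
  - by rewrite -lev0.
  move: (level _) (lev0 i) lev => m mE; move: (level _) (lev0 j) => n nE.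
  by rewrite mE nE addSn addnS.
have [y [Xy yy]] := isotropic_extend Xfree Xiso.
pose b (g : sgen) := match g with inl i => X`_i | inr i => y i end.
have bS : standard_basis b by exact: standard_basisI.
have perp7 v : '[x4, v] = 0 -> '[x5, v] = 0 -> v \in perp (lcs 7).
  move=> v4 v5; have s57 : (<[x5]> <= lcs 7)%VS by rewrite -memvE.
  have d57 : (\dim (lcs 7) <= (\dim <[x5]>).+1)%N by rewrite d7 dim_vline x50.
  apply/perpP => u u7.
  have [c [_ [/vlineP[d ->] ->]]] := vs_split s57 d57 x47 x45 u7.
  by rewrite !saa_form_lin v4 v5 !mulr0 addr0.
have perp6 v : '[x3, v] = 0 -> v \in perp (lcs 7) -> v \in perp (lcs 6).
  move=> v3 /perpP v7; apply/perpP => u u6.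
  have d67 : (\dim (lcs 6) <= (\dim (lcs 7)).+1)%N by rewrite d6 d7.
  have [c [w [w7 ->]]] := vs_split (lcs_sub1 L 5) d67 x36 x37 u6.
  by rewrite !saa_form_lin v3 v7 // mulr0 addr0.
have perp5 v : '[x2, v] = 0 -> v \in perp (lcs 6) -> v \in perp (lcs 5).
  move=> v2 /perpP v6; apply/perpP => u u5.
  have d56 : (\dim (lcs 5) <= (\dim (lcs 6)).+1)%N by rewrite d5 d6.
  have [c [w [w6 ->]]] := vs_split (lcs_sub1 L 4) d56 x25 x26 u5.
  by rewrite !saa_form_lin v2 v6 // mulr0 addr0.
have b_level g : b g \in lcs (level g).
  case: g => [i|]; first exact: X_level.
  have xy i j : '[b (inl i), b (inr j)] = (i == j)%:R by rewrite Xy.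
  apply: forall_I5 => [|||/=|/=]; try exact: memvf.
  - rewrite (@perp_lcs_eq 3 4) ?d4 ?d5 //.
    by apply: (perp5); [exact: (xy (@Ordinal 5 1 isT))|apply: perp6;
      [exact: (xy (@Ordinal 5 2 isT))|apply: perp7;
      [exact: (xy (@Ordinal 5 3 isT))|exact: (xy (@Ordinal 5 4 isT))]]].
  - rewrite (@perp_lcs_eq 2 5) ?d3 ?d6 //.
    by apply: perp6; [exact: (xy (@Ordinal 5 2 isT))|apply: perp7;
      [exact: (xy (@Ordinal 5 3 isT))|exact: (xy (@Ordinal 5 4 isT))]].
  rewrite (@perp_lcs_eq 1 6) ?d2 ?d7 //.
  by apply: perp7;
    [exact: (xy (@Ordinal 5 3 isT))|exact: (xy (@Ordinal 5 4 isT))].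
have xy5 : '[x5, b 'y_5] = 1.
  by apply: etrans (Xy (@Ordinal 5 4 isT) (@Ordinal 5 4 isT)) _.
exists b; split;
  [exact: bS | exact: b_level | exact: x5m | split; first exact: x12m].
- have y24 : b 'y_2 \notin lcs 4.
    apply/negP => y24; have := @lcs_orth 4 3 _ _ isT x25 y24.
    rewrite [LHS](Xy (@Ordinal 5 1 isT) (@Ordinal 5 1 isT)).
    by move/eqP; rewrite oner_eq0.
  have d34 : (\dim (lcs 3) <= (\dim (lcs 4)).+1)%N by rewrite d3 d4.
  have [c [u [u4 zE]]] := vs_split (lcs_sub1 L 2) d34 (b_level 'y_2) y24 z23.
  have y22 : b 'y_2 \in lcs 2 := subvP (lcs_sub1 L 1) _ (b_level 'y_2).
  have [/vlineP[d dE] _] := x12m (b 'y_2) y22.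
  apply: contra x50 => /eqP; rewrite /trip dE saa_form_lin xy5 mulr1 => d0.
  rewrite -x1z2 zE !saa_mul_lin dE d0 (lcs_mul (i := 3) (j := 3) _ x14 u4) //.
  by rewrite scale0r scaler0 addr0.
have y33 : b 'y_3 \notin lcs 3.
  apply/negP => y33; have := @lcs_orth 5 2 _ _ isT x36 y33.
  rewrite [LHS](Xy (@Ordinal 5 2 isT) (@Ordinal 5 2 isT)).
  by move/eqP; rewrite oner_eq0.
have d23 : (\dim (lcs 2) <= (\dim (lcs 3)).+1)%N by rewrite d2 d3.
have [c [u [u4 zE]]] := vs_split (lcs_sub1 L 1) d23 (b_level 'y_3) y33 z32.
have [_ /vlineP[d dE]] := x12m (b 'y_3) (b_level 'y_3).
apply: contra x50 => /eqP; rewrite /trip dE saa_form_lin xy5 mulr1 => d0.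
rewrite -x2z3 zE !saa_mul_lin dE d0 (lcs_mul (i := 4) (j := 2) _ x25 u4) //.
by rewrite scale0r scaler0 addr0.
Qed.

(** The triples that vanish because [x_1 L^2] and [x_2 L^2] lie on the line of
    [x_5]. *)
Definition vanishing_supports : seq (seq sgen) :=
  [:: [:: 'x_1; 'y_2; 'y_3]; [:: 'x_1; 'y_2; 'y_4]; [:: 'x_1; 'y_3; 'y_4];
      [:: 'x_2; 'y_3; 'y_4]].

Definition listed_supports : seq (seq sgen) :=
  map (@supp F) (pres16 0 0 0 0 0 0 0 0 0 0 0 0 0 0 0 0).

(** The bound 8 is the one from which on [L^i L^j = 0]. *)
Definition classified (g h k : sgen) : bool :=
  [|| (8 <= level g + level h)%N, (8 <= level h + level k)%N,
      (8 <= level k + level g)%N, g == h, h == k, k == g,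
      has (perm_eq [:: g; h; k]) vanishing_supports
    | has (perm_eq [:: g; h; k]) listed_supports].

Lemma classifiedT g h k : classified g h k.
Proof.
have H : all (fun g => all (fun h => all (classified g h) sgens) sgens) sgens.
  by vm_compute.
move/allP/(_ g (mem_sgens g)): H.
by move/allP/(_ h (mem_sgens h))/allP/(_ k (mem_sgens k)).
Qed.

Lemma level_trip (b : sgen -> L) g h w : (forall g, b g \in lcs (level g)) ->
  (8 <= level g + level h)%N -> trip (b g) (b h) w = 0.
Proof.
have pos k : level k = (level k).-1.+1 by case: k; apply: forall_I5.
move=> bL gh; apply: (@lcs_trip (level g).-1 (level h).-1).
- by move: gh; rewrite {1}[level g]pos {1}[level h]pos addSn addnS.
- by rewrite -pos.
by rewrite -pos.
Qed.

Section RoughParameters.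
Variables (b : sgen -> L) (r f e q y1 y2 y3 g x1 x2 a1 a2 a3 b1 b2 b3 : F).
Hypotheses (b_level : forall g, b g \in lcs (level g))
  (x5_L4L3 : b 'x_5 \in saa_prodv (lcs 4) (lcs 3)) (e_neq0 : e != 0)
  (bP : given_by b (pres16 r f e q y1 y2 y3 g x1 x2 a1 a2 a3 b1 b2 b3)).
Let bS : standard_basis b := proj1 bP.
Let bT u v w : trip u v w =
    psum b (pres16 r f e q y1 y2 y3 g x1 x2 a1 a2 a3 b1 b2 b3) u v w
  := proj2 bP u v w.

Let y_coord_eq0 i k u : (8 <= k + level (inl i))%N -> u \in lcs k.+1 ->
  bcoord b (inr i) u = 0.
Proof.
have pos j : level j = (level j).-1.+1 by case: j; apply: forall_I5.
move=> ki uk; rewrite /= (lcs_orth (i := (level (inl i)).-1) (j := k)) //.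
by move: ki; rewrite {1}[level _]pos addnS addnC.
Qed.

(** Otherwise [x_3] would be central. *)
Lemma param_f_neq0 : f != 0.
Proof.
apply/eqP => f0.
have x3Z : b 'x_3 \in lcs 7.
  rewrite lcs7_center; apply/saa_centerP => v; apply/mul_eq0P => w.
  rewrite bT /psum /= !big_cons big_nil /det3 !(bcoord_basis bS) /= f0; ring.
have := lcs_orth (isT : (7 <= 6 + 1)%N) x3Z (b_level 'y_3).
by rewrite (saa_form_basis bS) => /eqP; rewrite oner_eq0.
Qed.

(** If [q = 0], then [L^4 L^3] is central, and being different from [L^7] it is
    the line of [x_5].  This makes [(y_1 y_2, y_4)] vanish, so that a suitable
    combination [v] of [y_1] and [x_1] annihilates [L^3].  Hence [v] is
    orthogonal to [L^4] and lies in [L^5], which its [y_1]-coordinate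
    forbids. *)
Lemma param_q_neq0 : q != 0.
Proof.
apply/eqP => q0; have [d4 d5 d6 d7] := dim_lcs.
have c2 u : u \in lcs 2 -> bcoord b 'y_4 u = 0 /\ bcoord b 'y_5 u = 0.
  by move=> u2; split; apply: y_coord_eq0 u2.
have c3 u : u \in lcs 3 ->
    [/\ bcoord b 'y_3 u = 0, bcoord b 'y_4 u = 0 & bcoord b 'y_5 u = 0].
  by move=> u3; split; apply: y_coord_eq0 u3.
have c4 u : u \in lcs 4 -> [/\ bcoord b 'y_2 u = 0, bcoord b 'y_3 u = 0,
    bcoord b 'y_4 u = 0 & bcoord b 'y_5 u = 0].
  by move=> u4; split; apply: y_coord_eq0 u4.
have x50 : b 'x_5 != 0.
  apply/eqP => x50.
  have : '[b 'x_5, b 'y_5] = 1 by rewrite (saa_form_basis bS).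
  by rewrite x50 saa_form_lin => /esym/eqP; rewrite oner_eq0.
have L4L3 : saa_prodv (lcs 4) (lcs 3) = <[b 'x_5]>%VS.
  have sub7 : (saa_prodv (lcs 4) (lcs 3) <= lcs 7)%VS.
    apply/saa_prodvP => u v /c4[u2 u3 u4 u5] /c3[v3 v4 v5].
    rewrite lcs7_center -perp_lcs2; apply/perpP => w /c2[w4 w5].
    rewrite saa_formC -[saa_form _ _ _]/(trip u v w) bT /psum.
    rewrite /= !big_cons big_nil /=.
    rewrite /det3 u2 u3 u4 u5 v3 v4 v5 w4 w5 q0; ring.
  apply/esym/eqP; rewrite eqEdim -memvE x5_L4L3 dim_vline x50 /=.
  rewrite leqNgt; apply: contra_notN L4L3_neq => d2.
  by apply/eqP; rewrite eqEdim sub7 d7.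
have a30 : a3 = 0.
  have -> : a3 = trip (b 'y_1) (b 'y_2) (b 'y_4).
    by rewrite bT /psum /= !big_cons big_nil /det3 !(bcoord_basis bS) /=; ring.
  have : b 'y_1 *s b 'y_2 \in <[b 'x_5]>%VS.
    by rewrite -L4L3; apply: mem_saa_prodv;
      [exact: (b_level 'y_1)|exact: (b_level 'y_2)].
  by case/vlineP => c E; rewrite /trip E saa_form_lin (saa_form_basis bS) mulr0.
pose v := b 'y_1 - (b3 / e) *: b 'x_1.
have vL3 u w : u \in lcs 3 -> trip v u w = 0.
  case/c3 => u3 u4 u5.
  have vE k :
      bcoord b k v = bcoord b k (b 'y_1) - (b3 / e) * bcoord b k (b 'x_1).
    by case: k => k; rewrite /= !saa_form_lin.
  rewrite bT /psum /= !big_cons big_nil /= /det3 u3 u4 u5 !vE.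
  by rewrite !(bcoord_basis bS) /= q0 a30; field.
have : v \in perp (lcs 4).
  apply/perp_prodv => w; apply/perpP => u u3.
  by rewrite saa_form_mulr -[saa_form _ _ _]/(trip u w v) -trip_cyc vL3 ?oppr0.
have <- : lcs 5 = perp (lcs 4) by apply: (@perp_lcs_eq 4 3); rewrite ?d4 ?d5.
move=> v5; have := lcs_orth (isT : (7 <= 4 + 3)%N) v5 (b_level 'x_1).
rewrite /v !saa_form_lin !(saa_form_basis bS) /= mulr0 subr0 => /eqP.
by rewrite oppr_eq0 oner_eq0.
Qed.
End RoughParameters.

Lemma rough_presentation :
  exists (b : sgen -> L) (r f e q y1 y2 y3 g x1 x2 a1 a2 a3 b1 b2 b3 : F),
    [/\ given_by b (pres16 r f e q y1 y2 y3 g x1 x2 a1 a2 a3 b1 b2 b3),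
        r != 0, f != 0, e != 0 & q != 0].
Proof.
have [b [bS bL x5m [x12m e0 r0]]] := adapted_basis.
pose t g h k := trip (b g) (b h) (b k).
have x5_orth v h : v \in <[b 'x_5]>%VS -> h != 'y_5 -> '[v, b h] = 0.
  move=> /vlineP[c ->]; rewrite saa_form_lin; case: h => i h5.
    by rewrite (saa_form_basis bS) mulr0.
  rewrite (saa_form_basis bS); move: h5.
  case: (_ =P i) => [<-|_ _]; last by rewrite mulr0.
  by rewrite eqxx.
have vanishing s g h k : s \in vanishing_supports -> perm_eq s [:: g; h; k] ->
    t g h k = 0.
  have tC x y z : t x y z = - t y x z by exact: tripC.
  have tcyc x y z : t x y z = t y z x by exact: trip_cyc.
  have b2 g' : (2 <= level g')%N -> b g' \in lcs 2.
    move=> l2; apply: subvP (bL g').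
    by case: (level g') l2 => // n ?; exact: lcs_sub.
  rewrite !inE => /or4P[] /eqP-> ghk; apply: (perm_alt_eq0 tcyc tC ghk).
  - by apply: x5_orth => //; have [] := x12m _ (b2 'y_2 isT).
  - by apply: x5_orth => //; have [] := x12m _ (b2 'y_2 isT).
  - by apply: x5_orth => //; have [] := x12m _ (b2 'y_3 isT).
  by apply: x5_orth => //; have [] := x12m _ (b2 'y_3 isT).
pose P := pres16 (t 'x_2 'y_3 'y_5) (t 'x_3 'y_4 'y_5)
   (t 'x_1 'y_2 'y_5) (t 'y_1 'y_2 'y_3)
   (t 'y_1 'y_4 'y_5) (t 'y_2 'y_4 'y_5) (t 'y_3 'y_4 'y_5)
   (t 'x_1 'y_3 'y_5) (t 'x_1 'y_4 'y_5) (t 'x_2 'y_4 'y_5)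
   (t 'y_2 'y_3 'y_4) (t 'y_1 'y_3 'y_4) (t 'y_1 'y_2 'y_4)
   (t 'y_2 'y_3 'y_5) (t 'y_1 'y_3 'y_5) (t 'y_1 'y_2 'y_5).
have bP : given_by b P.
  apply: given_byP => // [g h k a|g h k nP].
    have /allP H : all (fun e => t e.1.1.1 e.1.1.2 e.1.2 == e.2) P.
      by rewrite /= !eqxx.
    by move/H/eqP.
  rewrite -/(t g h k).
  have lev := @level_trip b _ _ _ bL.
  case/or4P: (classifiedT g h k)
    => [gh|hk|kg|/or4P[/eqP->|/eqP->|/eqP->|/orP[]]].
  - by rewrite /t lev.
  - by rewrite /t trip_cyc lev.
  - by rewrite /t -trip_cyc lev.
  - by rewrite /t trip_alt.
  - by rewrite /t trip_cyc trip_alt.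
  - by rewrite /t -trip_cyc trip_alt.
  - by case/hasP => s sV; rewrite perm_sym; apply: vanishing.
  case/hasP => s sP ghk; have /mapP[e eP sE] : s \in map (@supp F) P by [].
  by move: (nP e eP); rewrite -sE ghk.
exists b, (t 'x_2 'y_3 'y_5), (t 'x_3 'y_4 'y_5), (t 'x_1 'y_2 'y_5).
exists (t 'y_1 'y_2 'y_3).
do 12 eexists; split; [exact: bP | exact: r0 | | exact: e0 | ].
  exact: param_f_neq0 bL bP.
exact: param_q_neq0 bL x5m e0 bP.
Qed.
End Structure.

(** * The theorem *)

Theorem proposition8p7 (F : fieldType) :
  (forall L : saaType F,
     saa_nilpotent L ->
     \dim {:L} = 10%N ->
     saa_isotropic (saa_center L) ->
     \dim (saa_center L) = 2%N ->
     saa_class L 7 ->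
     saa_prodv (saa_lcs L 4) (saa_lcs L 3) <> saa_lcs L 7 ->
     (saa_prodv (saa_lcs L 5) (saa_lcs L 2)
        <= saa_prodv (saa_lcs L 4) (saa_lcs L 3))%VS ->
     \dim (saa_prodv
             (saa_transporter (saa_lcs L 4) (saa_lcs L 3)
                (saa_prodv (saa_lcs L 5) (saa_lcs L 2)))
             (saa_lcs L 2)) = 1%N ->
     exists2 r : F, r != 0 & presented_by L (P10_2_5 r)) /\
  (forall r s : F, r != 0 -> s != 0 ->
     forall L M : saaType F,
       presented_by L (P10_2_5 r) -> presented_by M (P10_2_5 s) ->
       (saa_isomorphic L M <-> exists2 a : F, a != 0 & s / r = a ^+ 3)).
Proof.
split=> [L _ dL _ dZ cL L4L3 L5L2 dUL2|r s r0 s0 L M LP MP]; last first.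
  exact: presented_isomorphic.
have [b [r [f [e [q [y1 [y2 [y3 [g [x1 [x2 [a1 [a2 [a3 [b1 [b2 [b3
    ]]]]]]]]]]]]]]]]] :=
  rough_presentation dL dZ cL L4L3 L5L2 dUL2.
case=> bP r0 f0 e0 q0.
have [s s0 [c cP]] := normal_form r0 f0 e0 q0 bP.
by exists s => //; exact: given_by_presented cP.
Qed.
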